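(* Fix $\kappa\in(0,1/3)$. There exist $C>0$ and an integer $L_0\ge1$ such that for all $L\ge L_0$ and all $x_0\in Q_{R_L-r_L}$, on the event $E_{L,x_0}=E_{L,x_0}(\kappa)$, $$\big|\lambda_1(Q_{R_L},\xi_L)-\bar\lambda_L-\Xi_L(x_0)\big|\le C\frac{d_L}{a_L}\Big(\Big(\frac{d_L}{a_L}\Big)^{1-2\kappa}|\xi_L(x_0)-a_L|+\frac1{a_L}\Big),$$ and $$\|\varphi_{R_L}-\bar\varphi_L(\cdot-x_0)\|_{\ell^2(Q_{R_L})}\le C\frac{d_L}{a_L}\sqrt{\Big(\frac{d_L}{a_L}\Big)^{1-2\kappa}|\xi_L(x_0)-a_L|+\frac1{a_L}},$$ where $\bar\varphi_L$ is extended by $0$ outside $Q_{r_L}$.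
   Context: Fix $d\ge1$; $|x|$ Euclidean norm; $Q_a=[-a/2,a/2]^d\cap\mathbb{Z}^d$, $Q_{a,x}=x+Q_a$, $Q_a^{\neq0}=Q_a\setminus\{0\}$; $u_L\ll v_L$ means $u_L/v_L\to0$. For each $L\ge1$, $(\xi_L(x))_{x\in\mathbb{Z}^d}$ is a centred shift-stationary Gaussian field with unit variance and non-negative covariance $v_L$ with (I) $\sup_{|x|\ge\exp(\sqrt{\ln L})}v_L(x)\ln|x|\to0$; (II) there are $\mathfrak c,\mathfrak c'>0$ with $1-e^{\mathfrak c'|x|}/d_L\le v_L(x)\le1-\mathfrak c/d_L$ for all $L,x\ne0$, where $\sup_{|x|=1}v_L(x)=1-1/d_L$. $a_L$: $\mathbb{P}(\xi_L(0)>a_L)=L^{-d}$. Fix $R_L,r_L$ with $a_L\ll\ln R_L\ll a_L^2/d_L$, $\ln a_L\le\ln r_L\ll\sqrt{a_L}$. $\Delta f(x)=\sum_{|y-x|=1}(f(y)-f(x))$; Dirichlet operators act on functions extended by $0$ outside the domain. $\lambda_1(Q_{R_L},\xi_L)$ and $\varphi_{R_L}\ge0$: principal eigenvalue and $\ell^2$-normalised eigenfunction of $\Delta+\xi_L$ on $Q_{R_L}$ (Dirichlet). $\mathcal{S}_L(x)=a_L(1-v_L(x))$; $\bar\lambda_L,\bar\varphi_L\ge0$: principal eigenvalue and normalised eigenfunction of $\Delta-\mathcal{S}_L$ on $Q_{r_L}$ (Dirichlet). $\zeta_{L,x_0}(x)=\xi_L(x)-\xi_L(x_0)v_L(x-x_0)$;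 $\Phi_L(y)=\sum_{x\in Q_{r_L}^{\neq0}}\bar\varphi_L(x)^2\zeta_{L,y}(x+y)$; $\tau_L^2=\mathrm{Var}(\Phi_L(y))$; $\Xi_L=\xi_L+\Phi_L$. Standing assumptions: $d_L\ll a_L$, $\tau_L\ll a_L^{-1}(a_L/d_L)^{1/2}$. With $\theta=2d+1$: $E_{L,x_0}(\kappa)=E^1\cap E^2\cap E^3$ with $E^1=\{|\xi_L(x_0)-a_L|<\theta\}$, $E^2=\{|\zeta_{L,x_0}(x)|\le\frac1{10}\mathcal{S}_L(x-x_0)\ \forall x\in Q_{2R_L,x_0}\}$, $E^3=\bigcap_{x\in Q_{R_L,x_0}\setminus\{x_0\}}\{|\zeta_{L,x_0}(x)|/\sqrt{\mathrm{Var}[\zeta_{L,x_0}(x)]}\le(a_L/d_L)^{\kappa|x-x_0|}\sqrt{1\vee(|\xi_L(x_0)-a_L|a_L)}\}$. *)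

(* Defs.v *)
From HB Require Import structures.
From mathcomp Require Import all_boot all_order all_algebra.
From mathcomp Require Import all_classical all_reals all_analysis.
Set Implicit Arguments.
Unset Strict Implicit.
Unset Printing Implicit Defensive.
Import Order.TTheory GRing.Theory Num.Theory.
Local Open Scope ring_scope.
Local Open Scope classical_set_scope.

Notation Zpt d := {ffun 'I_d -> int}.

Definition unitv (d : nat) (i : 'I_d) : Zpt d := [ffun j => ((i == j) : nat)%:Z].

Definition enorm {R : realType} (d : nat) (x : Zpt d) : R :=
  Num.sqrt (\sum_(i < d) ((x i)%:~R : R) ^+ 2).

(* x \in Q_a = [-a/2, a/2]^d \cap Z^d  (so x \in Q_{a,y} iff inbox a (x - y)). *)
Definition inbox {R : realType} (d : nat) (a : R) (x : Zpt d) : bool :=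
  [forall i, `|((x i)%:~R : R)| <= a / 2].

Definition cube (d N : nat) : seq (Zpt d) :=
  [seq [ffun i => (k i : nat)%:Z - N%:Z] | k : {ffun 'I_d -> 'I_(N.*2.+1)}].

Definition box {R : realType} (d : nat) (a : R) : seq (Zpt d) :=
  [seq x <- cube d `|Num.floor (`|a| / 2)|%N | inbox a x].

Definition lap {R : realType} (d : nat) (f : Zpt d -> R) (x : Zpt d) : R :=
  \sum_(i < d) ((f (x + unitv i) - f x) + (f (x - unitv i) - f x)).

Definition dirichlet_eigen {R : realType} (d : nat) (a : R) (V : Zpt d -> R)
    (lam : R) (f : Zpt d -> R) : Prop :=
  [/\ (forall x, ~~ inbox a x -> f x = 0),
      (exists x, f x != 0) &
      (forall x, inbox a x -> lap f x + V x * f x = lam * f x)].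

Definition principal_eigenpair {R : realType} (d : nat) (a : R) (V : Zpt d -> R)
    (lam : R) (f : Zpt d -> R) : Prop :=
  [/\ dirichlet_eigen a V lam f,
      (forall mu g, dirichlet_eigen a V mu g -> mu <= lam),
      (forall x, 0 <= f x) &
      \sum_(x <- box d a) f x ^+ 2 = 1].

Definition l2box {R : realType} (d : nat) (a : R) (f : Zpt d -> R) : R :=
  Num.sqrt (\sum_(x <- box d a) f x ^+ 2).

Definition centred_gaussian_law {R : realType} (s2 : R) (A : set R) : \bar R :=
  if s2 == 0 then ((\1_A : R -> R) 0)%:E else normal_prob 0 (Num.sqrt s2) A.

(* xi is a centred Gaussian field on Z^d with covariance E[xi x xi y] = v (x - y):
   every finite linear combination sum c_k xi(x_k) is N(0, sum c_k c_l v(x_k - x_l)). *)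
Definition gaussian_field {R : realType} {dT : measure_display}
    {T : measurableType dT} (P : probability T R) (d : nat)
    (xi : Zpt d -> T -> R) (v : Zpt d -> R) : Prop :=
  (forall x, measurable_fun setT (xi x)) /\
  (forall (s : seq (Zpt d * R)) (A : set R), measurable A ->
     P ((fun w => \sum_(p <- s) p.2 * xi p.1 w) @^-1` A) =
     centred_gaussian_law (\sum_(p <- s) \sum_(q <- s) p.2 * q.2 * v (p.1 - q.1)) A).

Definition negl {R : realType} (u w : nat -> R) : Prop :=
  (\forall L \near \oo, w L != 0) /\ ((fun L => u L / w L) @ \oo --> 0).

Definition zeta {R : realType} {T : Type} (d : nat) (xi : Zpt d -> T -> R)
    (v : Zpt d -> R) (x0 x : Zpt d) (w : T) : R :=
  xi x w - xi x0 w * v (x - x0).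

Definition Phi {R : realType} {T : Type} (d : nat) (xi : Zpt d -> T -> R)
    (v : Zpt d -> R) (r : R) (phibar : Zpt d -> R) (y : Zpt d) (w : T) : R :=
  \sum_(x <- box d r | x != 0) phibar x ^+ 2 * zeta xi v y (x + y) w.

Definition Xi {R : realType} {T : Type} (d : nat) (xi : Zpt d -> T -> R)
    (v : Zpt d -> R) (r : R) (phibar : Zpt d -> R) (y : Zpt d) (w : T) : R :=
  xi y w + Phi xi v r phibar y w.

(* The event E_{L,x0}(kappa) (for fixed L), with theta = 2d+1, S(x) = a(1 - v(x)). *)
Definition Eevent {R : realType} {dT : measure_display} {T : measurableType dT}
    (P : probability T R) (d : nat) (xi : Zpt d -> T -> R) (v : Zpt d -> R)
    (a dd RR kappa : R) (x0 : Zpt d) (w : T) : Prop :=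
  [/\ `|xi x0 w - a| < (2 * d + 1)%:R,
      (forall x, inbox (2 * RR) (x - x0) ->
         `|zeta xi v x0 x w| <= 10^-1 * (a * (1 - v (x - x0)))) &
      (forall x, inbox RR (x - x0) -> x != x0 ->
         `|zeta xi v x0 x w| / Num.sqrt (fine ('V_P[zeta xi v x0 x])%E)
           <= (a / dd) `^ (kappa * enorm (x - x0)) *
              Num.sqrt (Num.max 1 (`|xi x0 w - a| * a)))].

(* Main.v *)
(** Write [xi = xi(x0) v(. - x0) + zeta].  On the event, the potential
[xi - xi(x0)] vanishes at [x0] and is at most [- m] elsewhere in the box, with
[m] of order [a / D].  A non-negative eigenfunction is positive at [x0], so its
eigenvalue is at least [- 2 d]; hence [m f <= sum of f over the neighbours] off
the centre, which gives the geometric decay of [phibar].  Let [psi] be the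
translate of [phibar] to [x0] and [rho] its residual for the true operator.
Subtracting from [phi] the multiple of [psi] that agrees with it at [x0] leaves
a function vanishing at [x0], on which the operator has a gap of order [m]; this
yields [|phi - psi| = O(|rho| / m)] and a quadratic error [O(|rho|^2 / m)] for
the eigenvalue, whose first-order term [<rho, psi>] is [Phi] up to [O(D / a^2)].
Finally [|rho|^2] is estimated from the decay of [phibar], the variance bound
for [zeta] and the fact that the box of side [r >= a] truncates only mass
[O(1 / a)]. *)

Require Import Defs.
From HB Require Import structures.
From mathcomp Require Import all_boot all_order all_algebra.
From mathcomp Require Import all_classical all_reals all_analysis.
From mathcomp Require Import measurable_realfun.
From mathcomp Require Import ring lra zify.
Import Order.TTheory GRing.Theory Num.Theory.
Local Open Scope ring_scope.
Local Open Scope classical_set_scope.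

Set Implicit Arguments.
Unset Strict Implicit.
Unset Printing Implicit Defensive.

(** * Second moment of a centred normal law *)

Section gaussian_variance.
Context {R : realType}.
Local Notation mu := (@lebesgue_measure R).

(** The Radon-Nikodym derivative of the normal law and its density have equal integrals over
    measurable sets, so they agree almost everywhere. *)
Lemma ge0_integral_normal_prob (m s : R) (f : measurableTypeR R -> \bar R) :
  (forall x, 0 <= f x)%E -> measurable_fun [set: R] f ->
  (\int[normal_prob m s]_x f x = \int[mu]_x (f x * (normal_pdf m s x)%:E))%E.
Proof.
move=> f0 mf; have dom := normal_prob_dominates m s.
rewrite -(Radon_Nikodym_SigmaFinite.change_of_variables dom)//.
apply: ae_eq_integral => //.
- apply: emeasurable_funM => //.
  exact: measurable_int (Radon_Nikodym_SigmaFinite.f_integrable dom).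
- apply: emeasurable_funM => //; apply/measurable_EFinP.
  exact: measurable_normal_pdf.
- apply: ae_eqe_mul2l => /=; apply: integral_ae_eq => //=.
  + exact: Radon_Nikodym_SigmaFinite.f_integrable.
  + by apply/measurable_EFinP; exact: measurable_normal_pdf.
  + by move=> E _ mE; rewrite -Radon_Nikodym_SigmaFinite.f_integral.
Qed.

(* From [y <= exp y] at [y = x^2 / 4 s^2], the integrand [x^2 pdf_s] is at most
   [4 sqrt 2 s^2 pdf_(sqrt 2 s)]. *)
Lemma normal_second_moment_le (s : R) : 0 < s ->
  (\int[normal_prob 0 s]_x (x ^+ 2)%:E <= (8 * s ^+ 2)%:E)%E.
Proof.
move=> s0; have s20 : 0 < s ^+ 2 by rewrite exprn_gt0.
pose s' := Num.sqrt 2 * s.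
have s'0 : 0 < s' by rewrite mulr_gt0// sqrtr_gt0.
have s'2 : s' ^+ 2 = 2 * s ^+ 2 by rewrite exprMn sqr_sqrtr.
rewrite ge0_integral_normal_prob//; last 2 first.
- by move=> x; rewrite lee_fin sqr_ge0.
- by apply/measurable_EFinP; exact: measurable_funX.
rewrite -[leRHS]mule1 -(integral_normal_pdf 0 s') -ge0_integralZl//; last 3 first.
- by apply/measurable_EFinP; exact: measurable_normal_pdf.
- by move=> x _; rewrite lee_fin normal_pdf_ge0.
- by rewrite lee_fin mulr_ge0// ltW.
apply: ge0_le_integral => //.
- by move=> x _; rewrite -EFinM lee_fin mulr_ge0 ?sqr_ge0 ?normal_pdf_ge0.
- apply/measurable_EFinP/measurable_funM; first exact: measurable_funX.
  exact: measurable_normal_pdf.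
- by apply/measurable_EFinP/measurable_funM => //; exact: measurable_normal_pdf.
move=> x _; rewrite -!EFinM lee_fin !normal_pdfE ?gt_eqF//.
rewrite /normal_fun subr0 !mulNr s'2.
set y := x ^+ 2 / (4 * s ^+ 2).
have -> : x ^+ 2 / (s ^+ 2 *+ 2) = y + y.
  by rewrite /y; field; rewrite gt_eqF.
have -> : x ^+ 2 / ((2 * s ^+ 2) *+ 2) = y.
  by rewrite /y; field; rewrite gt_eqF.
have xE : x ^+ 2 = 4 * s ^+ 2 * y by rewrite /y; field; rewrite gt_eqF.
(* The peaks differ by the factor [sqrt 2], rounded up to 2; with the 4 of [xE] this produces the
   constant 8. *)
have peak : normal_peak s <= 2 * normal_peak s'.
  have pk0 : 0 < s ^+ 2 * pi *+ 2 by rewrite pmulrn_lgt0 ?mulr_gt0 ?pi_gt0.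
  rewrite /normal_peak s'2 (_ : 2 * s ^+ 2 * pi *+ 2 = 2 * (s ^+ 2 * pi *+ 2)); last first.
    by rewrite -mulrA mulrnAr.
  rewrite sqrtrM// invfM mulrA ler_peMl ?invr_ge0 ?sqrtr_ge0//.
  rewrite ler_pdivlMr ?sqrtr_gt0// mul1r.
  rewrite -(@ler_pXn2r _ 2) ?nnegrE ?sqrtr_ge0// sqr_sqrtr//; lra.
rewrite {1}xE opprD expRD.
have yle : y * expR (- y) <= 1.
  have := expR_ge1Dx y; rewrite expRN ler_pdivrMr ?expR_gt0// mul1r; lra.
have e0 : 0 < expR (- y) by exact: expR_gt0.
have e1 : expR (- y) <= 1.
  rewrite -[leRHS]expR0 ler_expR oppr_le0 /y mulr_ge0 ?sqr_ge0// invr_ge0; nra.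
have y0 : 0 <= y by rewrite /y mulr_ge0 ?sqr_ge0// invr_ge0; nra.
have pk : 0 <= normal_peak s' by exact: normal_peak_ge0.
have pk2 : 0 <= normal_peak s by exact: normal_peak_ge0.
set e := expR (- y) in yle e0 e1 *.
have -> : 4 * s ^+ 2 * y * (normal_peak s * (e * e)) =
  (4 * s ^+ 2 * e) * (normal_peak s * (y * e)) by ring.
have -> : 8 * s ^+ 2 * (normal_peak s' * e) =
  (4 * s ^+ 2 * e) * (2 * normal_peak s') by ring.
apply: ler_wpM2l; first by rewrite !mulr_ge0// ltW.
by apply: le_trans peak; rewrite ler_piMr.
Qed.

End gaussian_variance.

(** * Variance of a random variable with Gaussian law *)

Section variance_of_gaussian.
Context {R : realType} {dT : measure_display} {T : measurableType dT}.
Variables (P : probability T R) (X : T -> R) (s2 : R).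
Hypotheses (mX : measurable_fun setT X) (s20 : 0 < s2).
Hypothesis lawX : forall A, measurable A -> P (X @^-1` A) = centred_gaussian_law s2 A.

Let s := Num.sqrt s2.
Let s0 : 0 < s. Proof. by rewrite sqrtr_gt0. Qed.
Let ss : s ^+ 2 = s2. Proof. by rewrite sqr_sqrtr// ltW. Qed.

Let lawXE A : measurable A -> P (X @^-1` A) = normal_prob 0 s A.
Proof. by move=> mA; rewrite lawX// /centred_gaussian_law gt_eqF. Qed.

Lemma gaussian_second_moment_le : (\int[P]_w (X w ^+ 2)%:E <= (8 * s2)%:E)%E.
Proof.
have := normal_second_moment_le s0; rewrite ss; apply: le_trans.
have mX' : @measurable_fun _ _ T (measurableTypeR R) setT X
  by exact: mX.
pose X' : {RV P >-> measurableTypeR R} :=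
  @mfun_Sub _ _ T (measurableTypeR R) X (mem_set mX').
have <- := @ge0_integral_distribution _ _ _ _ _ P X'
  (fun x : measurableTypeR R => (x ^+ 2)%:E); last 2 first.
- by apply/measurable_EFinP; exact: measurable_funX.
- by move=> y; rewrite lee_fin sqr_ge0.
rewrite le_eqVlt; apply/orP; left; apply/eqP.
apply: (@eq_measure_integral _ (measurableTypeR R) _ setT (normal_prob 0 s) (distribution P X')) => A mA _.
exact: lawXE.
Qed.

Lemma gaussian_Lfun2 : X \in Lfun P 2%:E.
Proof.
rewrite inE; apply/andP; split; rewrite inE//=.
rewrite /finite_norm unlock /Lnorm poweR_lty//.
apply: le_lt_trans (ltry (8 * s2)); apply: le_trans gaussian_second_moment_le.
apply: ge0_le_integral => //.
- move=> x _; exact: poweR_ge0.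
- apply/measurable_EFinP.
  apply: (@measurableT_comp _ _ _ _ _ _ (@powR R ^~ 2)) => //.
  exact: measurableT_comp.
- by apply/measurable_EFinP; exact: measurable_funX.
- by move=> t _ /=; rewrite lee_fin powR_mulrn// -normrX ger0_norm ?sqr_ge0.
Qed.

Lemma variance_gaussian_le : fine 'V_P[X] <= 8 * s2.
Proof.
have X2 := gaussian_Lfun2.
rewrite -lee_fin fineK ?variance_fin_num// varianceE//.
apply: le_trans gaussian_second_moment_le.
rewrite leeBlDr ?fin_numX ?expectation_fin_num ?Lfun_subset12 ?fin_num_measure//.
rewrite [X in (X <= _)%E](_ : _ = \int[P]_w (X w ^+ 2)%:E)%E; last by rewrite unlock.
by rewrite leeDl// sqre_ge0.
Qed.

(** With zero variance [X] would almost surely equal its mean, but a normal law has no atoms.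
    Positivity lets the quotient in the third condition of [Eevent] be cleared. *)
Lemma variance_gaussian_gt0 : 0 < fine 'V_P[X].
Proof.
have X2 := gaussian_Lfun2.
rewrite fine_gt0//; apply/andP; split; last by rewrite ltey_eq variance_fin_num.
rewrite lt0e variance_ge0 andbT; apply/negP => /eqP.
rewrite /variance unlock; set c := fine _.
rewrite unlock => V0.
have mXc : measurable_fun setT (fun w => ((X w - c) * (X w - c))%:E).
  by apply/measurable_EFinP/measurable_funM; apply: measurable_funB.
have : (\int[P]_w `|((X w - c) * (X w - c))%:E| = 0)%E.
  rewrite -V0; apply: eq_integral => w _.
  by rewrite gee0_abs// lee_fin -expr2 sqr_ge0.
move/(ae_eq_integral_abs P measurableT mXc) => [N [mN N0 sub]].
have mc : measurable [set c] by [].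
have Pc : P (X @^-1` [set c]) = 0%E.
  rewrite lawXE//.
  have /null_content_dominatesP := normal_prob_dominates 0 s; apply => //.
  exact: lebesgue_measure_set1.
have : (P setT <= P (N `|` X @^-1` [set c]))%E.
  apply: le_measure; rewrite ?inE//.
    apply: measurableU => //; have := mX measurableT mc; by rewrite setTI.
  move=> w _ /=; have [->|/eqP Xc] := pselect (X w = c); [by right|left].
  apply: sub => /= /(_ I) []/eqP; rewrite mulf_eq0 orbb subr_eq0.
  exact/negP.
rewrite probability_setT measureU0//; last first.
  by have := mX measurableT mc; rewrite setTI.
by rewrite N0 lee_fin ler10.
Qed.

End variance_of_gaussian.

(** * Finite sums over lists *)

Section finite_sums.
Context {R : realType} {T : eqType}.
Implicit Types (s : seq T) (f g h : T -> R).

(** Lagrange's identity: expand the double sum of the squares of [f x * g y - f y * g x]. *)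
Lemma sum_cauchy_schwarz s f g :
  (\sum_(x <- s) f x * g x) ^+ 2 <=
  (\sum_(x <- s) f x ^+ 2) * (\sum_(x <- s) g x ^+ 2).
Proof.
have : 0 <= \sum_(x <- s) \sum_(y <- s) (f x * g y - f y * g x) ^+ 2.
  by apply: sumr_ge0 => x _; apply: sumr_ge0 => y _; exact: sqr_ge0.
have -> : \sum_(x <- s) \sum_(y <- s) (f x * g y - f y * g x) ^+ 2 =
    \sum_(x <- s) \sum_(y <- s) (f x ^+ 2 * g y ^+ 2) +
    \sum_(x <- s) \sum_(y <- s) (g x ^+ 2 * f y ^+ 2) -
    2 * \sum_(x <- s) \sum_(y <- s) ((f x * g x) * (f y * g y)).
  rewrite mulr_sumr -big_split/= -sumrB; apply: eq_bigr => x _.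
  rewrite mulr_sumr -big_split/= -sumrB; apply: eq_bigr => y _; ring.
rewrite -!big_distrlr/= expr2; lra.
Qed.

(** Both sums reduce to the entries common to the two lists. *)
Lemma eq_sum_supp s s' h : uniq s -> uniq s' ->
  (forall x, x \in s -> x \notin s' -> h x = 0) ->
  (forall x, x \in s' -> x \notin s -> h x = 0) ->
  \sum_(x <- s) h x = \sum_(x <- s') h x.
Proof.
move=> us us' hs hs'.
have restr (u v : seq T) : (forall x, x \in u -> x \notin v -> h x = 0) ->
    \sum_(x <- u) h x = \sum_(x <- [seq x <- u | x \in v]) h x.
  move=> huv; rewrite big_filter [RHS]big_mkcond/= !big_seq.
  by apply: eq_bigr => x xu; case: ifPn => // /(huv _ xu).
rewrite (restr s s')// (restr s' s)//; apply: perm_big.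
apply: uniq_perm; rewrite ?filter_uniq// => x.
by rewrite !mem_filter andbC.
Qed.

Lemma le_sum_supp s s' h : uniq s -> uniq s' -> (forall x, 0 <= h x) ->
  (forall x, x \in s -> x \notin s' -> h x = 0) ->
  \sum_(x <- s) h x <= \sum_(x <- s') h x.
Proof.
move=> us us' h0 hs.
rewrite (@eq_sum_supp s [seq x <- s' | x \in s])// ?filter_uniq//.
- rewrite big_filter [leLHS]big_mkcond/=; apply: ler_sum => x _.
  by case: ifP.
- by move=> x xs; rewrite mem_filter xs => /hs; exact.
- by move=> x; rewrite mem_filter => /andP[->].
Qed.

Lemma le_term_sum s h x : (forall y, 0 <= h y) -> x \in s ->
  h x <= \sum_(y <- s) h y.
Proof.
move=> h0 xs; rewrite (big_rem x)//= lerDl; apply: sumr_ge0 => y _; exact: h0.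
Qed.

End finite_sums.

(** * Lattice boxes and distances *)

Section boxes.
Context {R : realType} {d : nat}.
Implicit Types (a b : R) (x y : Zpt d).

Lemma cube_uniq N : uniq (cube d N).
Proof.
rewrite map_inj_uniq ?enum_uniq// => k k' /ffunP kk'.
apply/ffunP => i; apply/val_inj; have := kk' i; rewrite !ffunE /=; lia.
Qed.

Lemma mem_cube N x : (forall i, (`|x i| <= N)%N) -> x \in cube d N.
Proof.
move=> xN; apply/mapP.
exists [ffun i => inord (absz (x i + N%:Z))]; rewrite ?mem_enum//.
apply/ffunP => i; rewrite !ffunE; move: (x i) (xN i) => z zN.
rewrite inordK; first by lia. lia.
Qed.

Lemma inboxP a x : reflect (forall i, `|(x i)%:~R : R| <= a / 2) (inbox a x).
Proof. exact: forallP. Qed.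

Lemma mem_box a x : (x \in box d a) = inbox a x.
Proof.
rewrite mem_filter andb_idr// => /inboxP xa; apply: mem_cube => i.
have fl0 : 0 <= Num.floor (`|a| / 2) by rewrite floor_ge0 divr_ge0.
rewrite -lez_nat (gez0_abs fl0) abszE floor_ge_int/= intr_norm.
apply: le_trans (xa i) _; rewrite ler_pM2r ?invr_gt0//; exact: ler_norm.
Qed.

Lemma box_uniq a : uniq (box d a).
Proof. by rewrite filter_uniq// cube_uniq. Qed.

Lemma sum_box_shift a b y (h : Zpt d -> R) :
  (forall x, ~~ inbox b x -> h x = 0) ->
  (forall x, inbox b x -> inbox a (x + y)) ->
  \sum_(x <- box d a) h (x - y) = \sum_(x <- box d b) h x.
Proof.
move=> hb ba; rewrite -(big_map (fun x => x - y) predT h).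
apply: eq_sum_supp; rewrite ?box_uniq ?map_inj_uniq ?box_uniq//.
- exact: addIr.
- by move=> x _; rewrite mem_box; exact: hb.
- move=> x; rewrite mem_box => /ba xa /mapP[]; exists (x + y); rewrite ?mem_box//.
  by rewrite addrK.
Qed.

(** The graph distance to 0: eigenfunctions lose a factor per lattice step, and natural exponents
    keep the sums geometric. *)
Definition l1norm x : nat := \sum_(i < d) `|x i|%N.

Lemma sum_unitv (i : 'I_d) : (\sum_(j < d) (i == j : nat) = 1)%N.
Proof.
rewrite (bigD1 i)//= eqxx big1// => j ji.
by rewrite eq_sym (negbTE ji).
Qed.

Lemma l1norm0 : l1norm 0 = 0%N.
Proof. by rewrite /l1norm big1// => i _; rewrite ffunE. Qed.

Lemma l1norm_eq0 x : (l1norm x == 0%N) = (x == 0).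
Proof.
apply/idP/eqP => [|->]; last by rewrite l1norm0.
rewrite sum_nat_eq0 => /forallP x0; apply/ffunP => i; rewrite ffunE.
by have := x0 i; rewrite absz_eq0 => /eqP.
Qed.

Lemma l1norm_gt0 x : (0 < l1norm x)%N = (x != 0).
Proof. by rewrite lt0n l1norm_eq0. Qed.

Lemma l1norm_addu x i : (l1norm x <= (l1norm (x + unitv i)%R).+1)%N.
Proof.
rewrite -addn1 -(sum_unitv i) -big_split/=; apply: leq_sum => j _.
rewrite !ffunE; case: (i == j) => /=; lia.
Qed.

Lemma l1norm_subu x i : (l1norm x <= (l1norm (x - unitv i)%R).+1)%N.
Proof.
rewrite -addn1 -(sum_unitv i) -big_split/=; apply: leq_sum => j _.
rewrite !ffunE; case: (i == j) => /=; lia.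
Qed.

Lemma enorm_le_l1norm x : enorm x <= (l1norm x)%:R :> R.
Proof.
rewrite -(@ler_pXn2r _ 2) ?nnegrE ?sqrtr_ge0// sqr_sqrtr; last first.
  by apply: sumr_ge0 => i _; exact: sqr_ge0.
have -> : \sum_(i < d) ((x i)%:~R : R) ^+ 2 = \sum_(i < d) (`|x i|%N%:R : R) ^+ 2.
  by apply: eq_bigr => i _; rewrite natr_absz intr_norm real_normK ?num_real.
rewrite /l1norm natr_sum.
(* Adding two terms only increases the square of the sum when both are non-negative, hence the first
   conjunct. *)
pose K (u w : R) := 0 <= w /\ u <= w ^+ 2.
suff [] : K (\sum_(i < d) (`|x i|%N%:R : R) ^+ 2) (\sum_(i < d) `|x i|%N%:R) by [].
apply: (big_ind2 K) => [|u w u' w' [w0 uw] [w'0 uw']|i _]; rewrite /K.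
- by rewrite expr0n.
- by split; [exact: addr_ge0 | rewrite sqrrD -mulr_natl; nra].
- by split.
Qed.

Lemma notin_box_l1norm a x : ~~ inbox a x -> a / 2 <= (l1norm x)%:R :> R.
Proof.
rewrite negb_forall => /existsP[i]; rewrite -ltNge => /ltW/le_trans; apply.
rewrite -intr_norm -natr_absz ler_nat.
by rewrite /l1norm (bigD1 i)//= leq_addr.
Qed.

End boxes.

(** * Geometric sums over boxes *)

Section geometric_sums.
Context {R : realType} {d : nat}.
Implicit Types (a p : R) (x : Zpt d).

Lemma sum_half_pow N :
  \sum_(j < N.*2.+1) (2^-1 : R) ^+ `|j%:Z - N%:Z|%N = 3 - 2 * 2^-1 ^+ N.
Proof.
elim: N => [|N IH].
  by rewrite big_ord1 !expr0; lra.
rewrite doubleS big_ord_recl big_ord_recr/=.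
transitivity (2^-1 ^+ N.+1 + (\sum_(j < N.*2.+1) (2^-1 : R) ^+ `|j%:Z - N%:Z|%N + 2^-1 ^+ N.+1)).
  congr (_ + (_ + _)).
  - by congr (_ ^+ _); lia.
  - by apply: eq_bigr => j _; congr (_ ^+ _); rewrite /bump /=; lia.
  - by congr (_ ^+ _); rewrite /bump /=; lia.
rewrite IH exprS; lra.
Qed.

(** The weight factorises over the coordinates, and each one-dimensional sum is at most 3. *)
Lemma sum_box_half_pow_le a :
  \sum_(x <- box d a) (2^-1 : R) ^+ l1norm x <= 3 ^+ d.
Proof.
set N := `|Num.floor (`|a| / 2)|%N.
apply: (@le_trans _ _ (\sum_(x <- cube d N) (2^-1 : R) ^+ l1norm x)).
  rewrite /box big_filter big_mkcond/=; apply: ler_sum => x _.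
  by case: ifP => // _; rewrite exprn_ge0.
rewrite /cube big_map big_enum/=.
under eq_bigr => k _.
  rewrite /l1norm -prodrXr.
  under eq_bigr => i _ do rewrite ffunE.
  over.
have := @bigA_distr_bigA R 0 1 *%R +%R 'I_d 'I_(N.*2.+1)
   (fun _ j => (2^-1 : R) ^+ `|j%:Z - N%:Z|%N).
move=> <-.
rewrite -[X in _ ^+ X]card_ord -prodr_const; apply: ler_prod => i _.
rewrite sum_half_pow; apply/andP; split.
  have : (2^-1 : R) ^+ N <= 1 by rewrite exprn_ile1//; lra.
  lra.
have : 0 <= (2^-1 : R) ^+ N by rewrite exprn_ge0.
lra.
Qed.

(** For [k >= 1] and [p <= 1/2] one has [p ^+ k <= 2 * p * 2^-1 ^+ k]; without the origin the sum is
    thus of first order in [p]. *)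
Lemma sum_box_pow_le a p : 0 <= p <= 2^-1 ->
  \sum_(x <- box d a | x != 0) p ^+ l1norm x <= 2 * 3 ^+ d * p.
Proof.
move=> /andP[p0 p1].
apply: (@le_trans _ _ (\sum_(x <- box d a) 2 * p * 2^-1 ^+ l1norm x)).
  rewrite big_mkcond/=; apply: ler_sum => x _; case: ifPn => [|_]; last first.
    by rewrite !mulr_ge0 ?exprn_ge0.
  rewrite -l1norm_gt0; case: (l1norm x) => // n _.
  rewrite !exprS (_ : 2 * p * (2^-1 * 2^-1 ^+ n) = p * 2^-1 ^+ n); last by field.
  by apply: ler_wpM2l => //; apply: lerXn2r; rewrite ?nnegrE.
rewrite -mulr_sumr [leRHS]mulrAC; apply: ler_wpM2l; rewrite ?mulr_ge0//.
exact: sum_box_half_pow_le.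
Qed.

End geometric_sums.

(** * Neighbour sums and the discrete Laplacian *)

Section neighbours.
Context {R : realType} {d : nat}.
Implicit Types (a : R) (x y z : Zpt d) (f g h : Zpt d -> R).

(** The hopping part of the Laplacian, separated from the diagonal [- 2 d] because it preserves
    positivity and has operator norm at most [2 d]. *)
Definition nbsum f x : R := \sum_(i < d) (f (x + unitv i) + f (x - unitv i)).

Local Notation n := (2 * d%:R : R).

Lemma lapE f x : lap f x = nbsum f x - n * f x.
Proof.
rewrite /lap /nbsum (_ : n * f x = \sum_(i < d) (f x + f x)); last first.
  rewrite sumr_const card_ord -[in RHS]mulr_natr; ring.
rewrite -sumrB; apply: eq_bigr => i _; ring.
Qed.

Lemma nbsum_ge0 f x : (forall y, 0 <= f y) -> 0 <= nbsum f x.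
Proof. by move=> f0; apply: sumr_ge0 => i _; rewrite addr_ge0. Qed.

Lemma nbsum_le_const f x (c : R) :
  (forall i, f (x + unitv i) <= c) -> (forall i, f (x - unitv i) <= c) ->
  nbsum f x <= n * c.
Proof.
move=> fp fm; apply: (@le_trans _ _ (\sum_(i < d) (c + c))).
  by apply: ler_sum => i _; exact: lerD.
rewrite sumr_const card_ord -mulr_natr; lra.
Qed.

Lemma nbsum_lin f g (t : R) x :
  nbsum (fun y => f y - t * g y) x = nbsum f x - t * nbsum g x.
Proof. by rewrite /nbsum mulr_sumr -sumrB; apply: eq_bigr => i _; ring. Qed.

Lemma nbsum_shift f x y : nbsum (fun z => f (z - y)) x = nbsum f (x - y).
Proof. by rewrite /nbsum; apply: eq_bigr => i _; rewrite !(addrAC x _ (- y)). Qed.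

(** Cauchy-Schwarz over the [d] directions, then [(u + w) ^+ 2 <= 2 * (u ^+ 2 + w ^+ 2)] in each. *)
Lemma sqr_nbsum_le f x : (nbsum f x) ^+ 2 <= n * nbsum (fun y => f y ^+ 2) x.
Proof.
have := sum_cauchy_schwarz (index_enum 'I_d)
  (fun i => f (x + unitv i) + f (x - unitv i)) (fun=> 1).
under eq_bigr do rewrite mulr1.
under [X in _ <= _ * X]eq_bigr do rewrite expr1n.
rewrite sumr_const card_ord => /le_trans; apply.
rewrite mulrC -mulrA mulrCA ler_wpM2l// /nbsum mulr_sumr.
apply: ler_sum => i _.
set u := f _; set w := f _; have := sqr_ge0 (u - w); rewrite !expr2; lra.
Qed.

(** None of the [2 d] translates of [h] has more mass in the box than [h] itself. *)
Lemma sum_nbsum_le a h : (forall x, 0 <= h x) ->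
  (forall x, ~~ inbox a x -> h x = 0) ->
  \sum_(x <- box d a) nbsum h x <= n * \sum_(x <- box d a) h x.
Proof.
move=> h0 ha; rewrite /nbsum exchange_big/=.
have shift y : \sum_(x <- box d a) h (x + y) <= \sum_(x <- box d a) h x.
  rewrite -(big_map (fun x => x + y) predT h).
  apply: le_sum_supp; rewrite ?map_inj_uniq ?box_uniq//; first exact: addIr.
  by move=> x _; rewrite mem_box; exact: ha.
apply: (@le_trans _ _ (\sum_(i < d) 2 * \sum_(x <- box d a) h x)).
  apply: ler_sum => i _; rewrite big_split/=.
  by have := shift (unitv i); have := shift (- unitv i); lra.
rewrite sumr_const card_ord -mulr_natr; lra.
Qed.

Lemma sum_sqr_nbsum_le a f : (forall x, ~~ inbox a x -> f x = 0) ->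
  \sum_(x <- box d a) nbsum f x ^+ 2 <= n ^+ 2 * \sum_(x <- box d a) f x ^+ 2.
Proof.
move=> fa; rewrite expr2 -mulrA.
apply: (@le_trans _ _ (n * \sum_(x <- box d a) nbsum (fun y => f y ^+ 2) x)).
  by rewrite mulr_sumr; apply: ler_sum => x _; exact: sqr_nbsum_le.
apply: ler_wpM2l; first by rewrite mulr_ge0.
apply: sum_nbsum_le => x; first exact: sqr_ge0.
by move=> /fa ->; rewrite expr0n.
Qed.

Lemma sum_nbsum_sym a f g :
  (forall x, ~~ inbox a x -> f x = 0) -> (forall x, ~~ inbox a x -> g x = 0) ->
  \sum_(x <- box d a) f x * nbsum g x = \sum_(x <- box d a) nbsum f x * g x.
Proof.
move=> fa ga.
have shift y : \sum_(x <- box d a) f x * g (x + y) =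
    \sum_(x <- box d a) f (x - y) * g x.
  transitivity (\sum_(x <- [seq x + y | x <- box d a]) f (x - y) * g x).
    by rewrite big_map; apply: eq_bigr => x _; rewrite addrK.
  apply: eq_sum_supp; rewrite ?map_inj_uniq ?box_uniq//; first exact: addIr.
    by move=> x _; rewrite mem_box => /ga ->; rewrite mulr0.
  move=> x _ xy; rewrite fa ?mul0r// -mem_box; apply: contra xy => xy.
  by apply/mapP; exists (x - y); rewrite ?subrK.
have shiftN y : \sum_(x <- box d a) f x * g (x - y) =
    \sum_(x <- box d a) f (x + y) * g x.
  by rewrite shift; apply: eq_bigr => x _; rewrite opprK.
under eq_bigr do rewrite mulr_sumr.
under [RHS]eq_bigr do rewrite mulr_suml.
rewrite exchange_big [RHS]exchange_big/=; apply: eq_bigr => i _.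
under eq_bigr do rewrite mulrDr.
under [RHS]eq_bigr do rewrite mulrDl.
by rewrite !big_split/= shift shiftN addrC.
Qed.

(** A coordinate where [y] differs from [x0] is moved one unit toward [x0]. The box is a product of
    intervals, so the new point [z] stays inside, and [f y] is one term of [nbsum f z]. *)
Lemma step_toward a x0 y : inbox a x0 -> inbox a y -> y != x0 ->
  exists z, [/\ inbox a z, (l1norm (z - x0)%R < l1norm (y - x0)%R)%N &
    forall f, (forall x, 0 <= f x) -> f y <= nbsum f z].
Proof.
move=> /inboxP x0a /inboxP ya yx0.
have [i yi] : exists i, y i != x0 i.
  by apply/existsP; rewrite -negb_forall; apply: contra yx0 => /forallP e;
     apply/eqP/ffunP => i; exact/eqP.
have l1lt z : (forall j, j != i -> z j = y j) -> (`|z i - x0 i| < `|y i - x0 i|)%N ->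
    (l1norm (z - x0)%R < l1norm (y - x0)%R)%N.
  move=> zy zi; rewrite /l1norm (bigD1 i)//= [ltnRHS](bigD1 i)//=.
  rewrite -addSn leq_add//; first by rewrite !ffunE; exact: zi.
  by apply: leq_sum => j ji; rewrite !ffunE zy.
have inz z : (forall j, j != i -> z j = y j) ->
    `|z i| <= Num.max `|x0 i| `|y i| -> inbox a z.
  move=> zy zi; apply/inboxP => j; have [->|ji] := eqVneq j i; last by rewrite zy.
  rewrite -intr_norm; apply: (@le_trans _ _ (Num.max `|x0 i| `|y i|)%:~R).
    by rewrite ler_int.
  by rewrite /Num.max; case: ifP => _; rewrite intr_norm.
have [lt|ge] := ltP (x0 i) (y i).
- exists (y - unitv i); split.
  + apply: inz => [j ji|]; first by rewrite !ffunE eq_sym (negbTE ji) subr0.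
    by rewrite !ffunE eqxx /=; move: (x0 i) (y i) yi lt => u w; lia.
  + apply: l1lt => [j ji|]; first by rewrite !ffunE eq_sym (negbTE ji) subr0.
    by rewrite !ffunE eqxx /=; move: (x0 i) (y i) yi lt => u w; lia.
  + move=> f f0; rewrite /nbsum (bigD1 i)//= subrK -addrA lerDl addr_ge0//.
    by apply: sumr_ge0 => j _; rewrite addr_ge0.
- exists (y + unitv i); split.
  + apply: inz => [j ji|]; first by rewrite !ffunE eq_sym (negbTE ji) addr0.
    by rewrite !ffunE eqxx /=; move: (x0 i) (y i) yi ge => u w; lia.
  + apply: l1lt => [j ji|]; first by rewrite !ffunE eq_sym (negbTE ji) addr0.
    by rewrite !ffunE eqxx /=; move: (x0 i) (y i) yi ge => u w; lia.
  + move=> f f0; rewrite /nbsum (bigD1 i)//= addrK [X in _ <= X + _]addrC -addrA lerDl.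
    by rewrite addr_ge0//; apply: sumr_ge0 => j _; rewrite addr_ge0.
Qed.

End neighbours.

(** * Positivity and decay of non-negative eigenfunctions *)

Section ground_state.
Context {R : realType} {d : nat}.
Implicit Types (a lam m : R) (V f : Zpt d -> R) (x : Zpt d).
Local Notation n := (2 * d%:R : R).

Lemma eigen_nbsum a V lam f x : dirichlet_eigen a V lam f -> inbox a x ->
  nbsum f x = (lam + n - V x) * f x.
Proof. by move=> [_ _ eq] /eq; rewrite lapE; lra. Qed.

(** A zero at [x0] would spread: where [f] vanishes, so does [nbsum f], and by non-negativity [f]
    vanishes at the neighbours. Induction on the distance to [x0] then contradicts [f] being
    non-zero. *)
Lemma eigen_gt0 a V lam f x0 : dirichlet_eigen a V lam f ->
  (forall x, 0 <= f x) -> inbox a x0 -> 0 < f x0.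
Proof.
move=> eig f0 x0a; rewrite lt_neqAle f0 andbT; apply/negP => /eqP fx0.
have fz k x : inbox a x -> (l1norm (x - x0)%R <= k)%N -> f x = 0.
  elim: k x => [|k IH] x xa.
    by rewrite leqn0 l1norm_eq0 subr_eq0 => /eqP ->.
  move=> xk; have [->//|xx0] := eqVneq x x0.
  have [z [za zx /(_ _ f0) fxz]] := step_toward x0a xa xx0.
  apply/eqP; rewrite eq_le f0 andbT (le_trans fxz)//.
  by rewrite (eigen_nbsum eig za) IH ?mulr0// -ltnS (leq_trans zx).
have [out [x /eqP fx] _] := eig; apply: fx.
by have [xa|/out//] := boolP (inbox a x); exact: fz (leqnn _).
Qed.

Lemma eigen_ge a V lam f x0 : dirichlet_eigen a V lam f ->
  (forall x, 0 <= f x) -> inbox a x0 -> V x0 - n <= lam.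
Proof.
move=> eig f0 x0a; have fx0 := eigen_gt0 eig f0 x0a.
have := nbsum_ge0 x0 f0; rewrite (eigen_nbsum eig x0a) pmulr_lge0//; lra.
Qed.

Lemma eigen_nbsum_ge a V lam f x0 m : dirichlet_eigen a V lam f ->
  (forall x, 0 <= f x) -> inbox a x0 ->
  (forall x, inbox a x -> x != x0 -> m <= V x0 - V x) ->
  forall x, x != x0 -> m * f x <= nbsum f x.
Proof.
move=> eig f0 x0a Vm x xx0; have [xa|xa] := boolP (inbox a x); last first.
  by have [-> //] := eig; rewrite mulr0 nbsum_ge0.
rewrite (eigen_nbsum eig xa) ler_wpM2r//.
by have := eigen_ge eig f0 x0a; have := Vm _ xa xx0; lra.
Qed.

(** Square [m * f x <= nbsum f x], sum off [x0], and use the norm bound [n] for the neighbour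
    sum. *)
Lemma sum_sqr_off_le a f x0 m : 0 <= m -> (forall x, 0 <= f x) ->
  (forall x, ~~ inbox a x -> f x = 0) -> inbox a x0 ->
  \sum_(x <- box d a) f x ^+ 2 = 1 ->
  (forall x, x != x0 -> m * f x <= nbsum f x) ->
  m ^+ 2 * (1 - f x0 ^+ 2) <= n ^+ 2.
Proof.
move=> m0 f0 fa x0a f1 fm.
have : \sum_(x <- box d a) nbsum f x ^+ 2 <= n ^+ 2.
  by have := sum_sqr_nbsum_le fa; rewrite f1 mulr1.
apply: le_trans; rewrite -{1}f1 (bigD1_seq x0)/= ?mem_box ?box_uniq//.
rewrite addrAC subrr add0r mulr_sumr big_mkcond/=.
apply: ler_sum => x _; case: ifPn => [xx0|_]; last exact: sqr_ge0.
rewrite -exprMn; apply: lerXn2r; rewrite ?nnegrE ?mulr_ge0 ?nbsum_ge0//.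
exact: fm.
Qed.

Lemma ground_state_decay a f m : 0 < m -> (forall x, 0 <= f x) ->
  (forall x, ~~ inbox a x -> f x = 0) ->
  \sum_(x <- box d a) f x ^+ 2 = 1 ->
  (forall x, x != 0 -> m * f x <= nbsum f x) ->
  forall x, f x <= (n / m) ^+ l1norm x.
Proof.
move=> m0 f0 fa f1 fm x.
(* Allowing every [k] up to the distance lets the induction reach all neighbours: those of a site at
   distance at least [k.+1] are at distance at least [k]. *)
suff H k y : (k <= l1norm y)%N -> f y <= (n / m) ^+ k by exact: H.
elim: k y => [|k IH] y ky.
  have [ya|/fa ->//] := boolP (inbox a y).
  rewrite expr0 -(@ler_pXn2r _ 2) ?nnegrE// expr1n -f1.
  by apply: (@le_term_sum _ _ _ (fun z => f z ^+ 2)); rewrite ?mem_box// => z; exact: sqr_ge0.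
have y0 : y != 0 by rewrite -l1norm_gt0 (leq_trans _ ky).
rewrite exprS mulrAC ler_pdivlMr// mulrC (le_trans (fm _ y0))//.
apply: nbsum_le_const => i; apply: IH; rewrite -ltnS (leq_trans ky)//.
  exact: l1norm_addu.
exact: l1norm_subu.
Qed.

End ground_state.

(** * Perturbation of an eigenpair under a spectral gap *)

Section perturbation.
Context {R : realType} {d : nat}.
Variables (a m lam mu : R) (M phi psi : Zpt d -> R) (x0 : Zpt d).
Local Notation n := (2 * d%:R : R).
Hypotheses (m0 : 0 < m) (nm : 8 * n <= m) (x0a : inbox a x0).
Hypotheses (Mx0 : M x0 = 0) (Mm : forall x, inbox a x -> x != x0 -> M x <= - m).
Hypotheses (eig : dirichlet_eigen a M lam phi) (phi0 : forall x, 0 <= phi x).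
Hypothesis phi1 : \sum_(x <- box d a) phi x ^+ 2 = 1.
Hypotheses (psi0 : forall x, 0 <= psi x) (psia : forall x, ~~ inbox a x -> psi x = 0).
Hypothesis psi1 : \sum_(x <- box d a) psi x ^+ 2 = 1.
Hypothesis psim : m ^+ 2 * (1 - psi x0 ^+ 2) <= n ^+ 2.

Definition residual x : R := lap psi x + M x * psi x - mu * psi x.

Local Notation rho := residual.

Let e := \sum_(x <- box d a) rho x ^+ 2.
Let ip := \sum_(x <- box d a) psi x * phi x.
Let del := lam - mu.

Let e0 : 0 <= e. Proof. by apply: sumr_ge0 => x _; exact: sqr_ge0. Qed.

Let phia x : ~~ inbox a x -> phi x = 0. Proof. by case: eig => + _ _; exact. Qed.

Let n64 : n ^+ 2 <= m ^+ 2 / 64.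
Proof.
have : (8 * n) ^+ 2 <= m ^+ 2.
  by apply: lerXn2r; rewrite ?nnegrE ?mulr_ge0// ltW.
rewrite (exprMn 2 8); lra.
Qed.

(** By [n64] the mass off [x0] is at most 1/64, and [f x0 >= f x0 ^+ 2] since [f x0 <= 1]. *)
Let value_near1 (f : Zpt d -> R) : (forall x, 0 <= f x) ->
  \sum_(x <- box d a) f x ^+ 2 = 1 ->
  m ^+ 2 * (1 - f x0 ^+ 2) <= n ^+ 2 -> 63 / 64 <= f x0 <= 1.
Proof.
move=> f0 f1 fm; have m20 : 0 < m ^+ 2 by rewrite exprn_gt0.
have fle : f x0 ^+ 2 <= 1.
  rewrite -f1; apply: (@le_term_sum _ _ _ (fun z => f z ^+ 2)); rewrite ?mem_box//.
  by move=> z; exact: sqr_ge0.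
have fle1 : f x0 <= 1 by rewrite -(@ler_pXn2r _ 2) ?nnegrE// expr1n.
have : 63 / 64 <= f x0 ^+ 2.
  have : m ^+ 2 * (1 - f x0 ^+ 2) <= m ^+ 2 * (1 / 64)
    by apply: le_trans fm _; have := n64; lra.
  rewrite ler_pM2l//; lra.
rewrite fle1 andbT; have := f0 x0; rewrite expr2; nra.
Qed.

Let phix0 : 63 / 64 <= phi x0 <= 1.
Proof.
apply: value_near1 => //; apply: (@sum_sqr_off_le _ _ a) => //; first exact: ltW.
apply: (eigen_nbsum_ge eig) => // x xa xx0.
by rewrite Mx0; have := Mm xa xx0; lra.
Qed.

Let psix0 : 63 / 64 <= psi x0 <= 1. Proof. exact: value_near1. Qed.

Let ip_ge : 2^-1 <= ip.
Proof.
have : psi x0 * phi x0 <= ip.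
  apply: (@le_term_sum _ _ _ (fun x => psi x * phi x)); rewrite ?mem_box//.
  by move=> x; rewrite mulr_ge0.
apply: le_trans; have := phix0; have := psix0; nra.
Qed.

(** Self-adjointness: moved from [psi] onto [phi], the operator acts as [lam]. *)
Lemma residual_inner : del * ip = \sum_(x <- box d a) rho x * phi x.
Proof.
have -> : \sum_(x <- box d a) rho x * phi x =
    \sum_(x <- box d a) nbsum psi x * phi x +
    \sum_(x <- box d a) (M x - n - mu) * (psi x * phi x).
  rewrite -big_split/=; apply: eq_bigr => x _; rewrite /rho lapE; ring.
rewrite -sum_nbsum_sym// -big_split/= /ip mulr_sumr !big_seq.
apply: eq_bigr => x; rewrite mem_box => xa.
by rewrite (eigen_nbsum eig xa) /del; ring.
Qed.

Let del_le : del ^+ 2 <= 4 * e.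
Proof.
have := sum_cauchy_schwarz (box d a) rho phi; rewrite -residual_inner phi1 mulr1.
rewrite exprMn -/e => h.
have : del ^+ 2 * 4^-1 <= del ^+ 2 * ip ^+ 2.
  apply: ler_wpM2l; first exact: sqr_ge0.
  have := ip_ge; nra.
lra.
Qed.

Let t := phi x0 / psi x0.
Let g x := phi x - t * psi x.
Let G := \sum_(x <- box d a) g x ^+ 2.

Let psix0_gt0 : 0 < psi x0. Proof. have := psix0; lra. Qed.

Let t_bounds : 2^-1 <= t <= 2.
Proof.
rewrite /t ler_pdivlMr// ler_pdivrMr//; have := phix0; have := psix0; lra.
Qed.

Let gx0 : g x0 = 0. Proof. by rewrite /g /t divfK ?subrr// gt_eqF. Qed.

Let ga x : ~~ inbox a x -> g x = 0.
Proof. by move=> xa; rewrite /g phia// psia// mulr0 subr0. Qed.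

Let G0 : 0 <= G. Proof. by apply: sumr_ge0 => x _; exact: sqr_ge0. Qed.

(** Off [x0] the factor [lam + n - M x] multiplying [g x] is at least [m]. Squaring costs a factor 2
    on each term, and [t ^+ 2 <= 4] makes the second one 8. *)
Let pointwise x : inbox a x ->
  m ^+ 2 * g x ^+ 2 <= 2 * nbsum g x ^+ 2 + 8 * (rho x - del * psi x) ^+ 2.
Proof.
move=> xa; have [->|xx0] := eqVneq x x0.
  by rewrite gx0 expr0n mulr0 addr_ge0// mulr_ge0// sqr_ge0.
have key : (lam + n - M x) * g x = nbsum g x + t * (rho x - del * psi x).
  rewrite /g nbsum_lin mulrBr -(eigen_nbsum eig xa) /rho lapE /del; ring.
have lm : - n <= lam by have := eigen_ge eig phi0 x0a; rewrite Mx0; lra.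
have Km : m <= lam + n - M x by have := Mm xa xx0; lra.
have : m ^+ 2 * g x ^+ 2 <= ((lam + n - M x) * g x) ^+ 2.
  rewrite exprMn; apply: ler_wpM2r; first exact: sqr_ge0.
  by apply: lerXn2r; rewrite ?nnegrE ?(ltW m0)// (le_trans (ltW m0) Km).
move/le_trans; apply; rewrite key.
set u := nbsum g x; set w := rho x - _.
have tw : (t * w) ^+ 2 <= 4 * w ^+ 2.
  rewrite exprMn; apply: ler_wpM2r; first exact: sqr_ge0.
  have := t_bounds; nra.
have := sqr_ge0 (u - t * w); rewrite sqrrB sqrrD; lra.
Qed.

Let G_le : m ^+ 2 * G <= 160 * e.
Proof.
have r_le : \sum_(x <- box d a) (rho x - del * psi x) ^+ 2 <= 10 * e.
  apply: (@le_trans _ _ (\sum_(x <- box d a)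
     (2 * rho x ^+ 2 + 2 * del ^+ 2 * psi x ^+ 2))).
    apply: ler_sum => x _; rewrite -(mulrA 2) -exprMn.
    move: (rho x) (del * psi x) => u w; have := sqr_ge0 (u + w).
    rewrite sqrrD sqrrB; lra.
  rewrite big_split/= -!mulr_sumr psi1 -/e; have := del_le; lra.
have nb_le := sum_sqr_nbsum_le ga.
(* As [n ^+ 2 <= m ^+ 2 / 64], the first term is at most [m ^+ 2 * G / 32] and is absorbed on the
   left; 80 becomes 160 with room to spare. *)
have : m ^+ 2 * G <= 2 * (n ^+ 2 * G) + 8 * (10 * e).
  apply: (@le_trans _ _ (2 * (\sum_(x <- box d a) nbsum g x ^+ 2) +
      8 * \sum_(x <- box d a) (rho x - del * psi x) ^+ 2)).
    rewrite !mulr_sumr -big_split/= !big_seq; apply: ler_sum => x.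
    by rewrite mem_box; exact: pointwise.
  by apply: lerD; apply: ler_wpM2l.
have : n ^+ 2 * G <= m ^+ 2 / 64 * G by exact: ler_wpM2r.
have : 0 <= m ^+ 2 * G by rewrite mulr_ge0// sqr_ge0.
lra.
Qed.

(** The squared distance is [2 - 2 * ip], while [G = (1 - t) ^+ 2 + 2 * t * (1 - ip)] is at least
    [1 - ip] because [t >= 1/2]. *)
Lemma eigenvector_perturbation :
  m ^+ 2 * (\sum_(x <- box d a) (phi x - psi x) ^+ 2) <= 320 * e.
Proof.
have -> : \sum_(x <- box d a) (phi x - psi x) ^+ 2 = 2 - 2 * ip.
  transitivity (\sum_(x <- box d a) (phi x ^+ 2 + psi x ^+ 2 - 2 * (psi x * phi x))).
    by apply: eq_bigr => x _; ring.
  by rewrite sumrB big_split/= phi1 psi1 -mulr_sumr -/ip; ring.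
have GE : G = 1 + t ^+ 2 - 2 * t * ip.
  transitivity (\sum_(x <- box d a)
      (phi x ^+ 2 + t ^+ 2 * psi x ^+ 2 - 2 * t * (psi x * phi x))).
    by apply: eq_bigr => x _; rewrite /g; ring.
  by rewrite sumrB big_split/= phi1 -!mulr_sumr psi1 -/ip; ring.
have tb := t_bounds.
have ip1 : ip <= 1.
  have := sum_cauchy_schwarz (box d a) psi phi; rewrite phi1 psi1 -/ip; nra.
have : 2 - 2 * ip <= 2 * G.
  have : 0 <= (t - 2^-1) * (1 - ip) by apply: mulr_ge0; lra.
  by have := sqr_ge0 (1 - t); rewrite GE sqrrB expr1n !mulrBr mulrBl; lra.
move=> /(ler_wpM2l (sqr_ge0 m)); have := G_le; lra.
Qed.

(** Inserting [phi = t * psi + g] into [residual_inner] gives [t * D = A - del * B], where each term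
    on the right pairs [rho] or [del] with [g] and is therefore quadratic in the residual. *)
Lemma eigenvalue_perturbation :
  m * `|lam - mu - \sum_(x <- box d a) rho x * psi x| <= 78 * e.
Proof.
have absle (u w : R) : 0 <= w -> u ^+ 2 <= w ^+ 2 -> `|u| <= w.
  by move=> w0; rewrite -(real_normK (num_real u)) ler_pXn2r ?nnegrE//.
set A := \sum_(x <- box d a) rho x * g x.
set B := \sum_(x <- box d a) psi x * g x.
set D := lam - mu - _.
have tD : t * D = A - del * B.
  have ipE : ip = B + t.
    rewrite -[t]mulr1 -psi1 mulr_sumr -big_split/=; apply: eq_bigr => x _.
    by rewrite /g; ring.
  have : del * ip = A + t * \sum_(x <- box d a) rho x * psi x.
    rewrite residual_inner mulr_sumr -big_split/=; apply: eq_bigr => x _.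
    by rewrite /g; ring.
  rewrite ipE /D -/del; lra.
(* The constants: [13 ^ 2 >= 160], then [26 ^ 2 >= 4 * 160], and 78 is twice [13 + 26] because
   [t >= 1/2]. *)
have mA : `|m * A| <= 13 * e.
  apply: absle; first by rewrite mulr_ge0.
  rewrite !exprMn.
  have : A ^+ 2 <= e * G by exact: sum_cauchy_schwarz.
  move=> /(ler_wpM2l (sqr_ge0 m)).
  have := ler_wpM2l e0 G_le; nra.
have mB : `|m * (del * B)| <= 26 * e.
  apply: absle; first by rewrite mulr_ge0.
  have BG : B ^+ 2 <= G.
    by have := sum_cauchy_schwarz (box d a) psi g; rewrite psi1 mul1r.
  have -> : (m * (del * B)) ^+ 2 = del ^+ 2 * (m ^+ 2 * B ^+ 2) by ring.
  apply: (@le_trans _ _ ((4 * e) * (160 * e))); last by nra.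
  apply: ler_pM; [exact: sqr_ge0|by rewrite mulr_ge0 ?sqr_ge0|exact: del_le|].
  by apply: le_trans G_le; apply: ler_wpM2l; rewrite ?sqr_ge0.
have mtD : m * (t * `|D|) <= 39 * e.
  have -> : m * (t * `|D|) = `|m * A - m * (del * B)|.
    have t0 : 0 <= t by have := t_bounds; lra.
    by rewrite -mulrBr -tD (normrM m) (normrM t) (gtr0_norm m0) (ger0_norm t0).
  apply: le_trans (ler_normB _ _) _; lra.
have : m * (2^-1 * `|D|) <= m * (t * `|D|).
  apply: ler_wpM2l; first exact: ltW.
  by apply: ler_wpM2r => //; have := t_bounds; lra.
lra.
Qed.

End perturbation.

(** * Deterministic estimates at a fixed scale *)

Section fixed_scale.
Context {R : realType} {d : nat}.
Local Notation n := (2 * d%:R : R).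
Local Notation theta := ((2 * d + 1)%:R : R).

(* [b] stands for [exp c'], [eta] for [(D / a) `^ (1 - 2 kappa)]. *)
Variables (a D r RR c b eta lbar lam : R).
Variables (v xi phibar phi : Zpt d -> R) (x0 : Zpt d).

Local Notation eps := (D / a).
Local Notation K := (2 * n / c).
Local Notation s := (xi x0 - a).
Local Notation z := (fun x => xi x - xi x0 * v (x - x0)).
Local Notation S3 := (2 * 3 ^+ d : R).

Hypotheses (D0 : 0 < D) (a1 : 1 <= a) (ar : a <= r) (thetaa : 5 * theta <= 2 * a).
Hypotheses (c0 : 0 < c) (b1 : 1 <= b) (eta01 : 0 <= eta <= 1).
Hypotheses (eps1 : eps <= 1) (Keps : K * eps <= 8^-1).
Hypothesis bKeps : b ^+ 2 * K ^+ 2 * eps <= 2^-1.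
Hypotheses (v0 : v 0 = 1).
Hypothesis vlb : forall x, x != 0 -> 1 - b ^+ l1norm x / D <= v x.
Hypothesis vub : forall x, x != 0 -> v x <= 1 - c / D.
Hypothesis x0R : inbox (RR - r) x0.
Hypothesis xix0 : `|s| <= theta.
Hypothesis zS : forall x, inbox (2 * RR) (x - x0) -> `|z x| <= 10^-1 * (a * (1 - v (x - x0))).
Hypothesis z2 : forall y, inbox r y -> y != 0 ->
  z (y + x0) ^+ 2 <= 16 / D * (1 + `|s| * a) * (b * (eta / eps)) ^+ l1norm y.
Hypothesis eigbar : principal_eigenpair r (fun x => - (a * (1 - v x))) lbar phibar.
Hypothesis eigphi : principal_eigenpair RR xi lam phi.

(** Half the lower bound [a * c / D] of [a * (1 - v)] off the origin, so that one gap serves both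
    the deterministic and the random potential. *)
Let m := c / (2 * eps).
Let q := K * eps.
Let M x := xi x - xi x0.
Let psi x := phibar (x - x0).

Let a0 : 0 < a. Proof. exact: lt_le_trans a1. Qed.
Let eps0 : 0 < eps. Proof. by rewrite divr_gt0. Qed.
Let m0 : 0 < m. Proof. by rewrite divr_gt0// mulr_gt0. Qed.
Let n0 : 0 <= n. Proof. by rewrite mulr_ge0. Qed.
Let K0 : 0 <= K. Proof. by rewrite divr_ge0 ?mulr_ge0// ltW. Qed.
Let q0 : 0 <= q. Proof. by rewrite mulr_ge0// ltW. Qed.
Let b0 : 0 <= b. Proof. exact: le_trans b1. Qed.
Let S30 : 0 <= S3. Proof. by rewrite mulr_ge0// exprn_ge0. Qed.
Let mE : m = a / 2 * (c / D).
Proof. by rewrite /m; field; rewrite !gt_eqF. Qed.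

Let nmq : n / m = q.
Proof. by rewrite /m /q; field; rewrite !gt_eqF. Qed.

Let nm : 8 * n <= m.
Proof. by have := Keps; rewrite -/q -nmq ler_pdivrMr//; lra. Qed.

Let r0 : 0 < r. Proof. exact: lt_le_trans ar. Qed.

Let box0 : inbox r (0 : Zpt d).
Proof. by apply/inboxP => i; rewrite ffunE normr0 divr_ge0// ltW. Qed.

Let one_sub_v_ge x : x != 0 -> c / D <= 1 - v x.
Proof. by move=> /vub; lra. Qed.

Let one_sub_v_ge0 x : 0 <= 1 - v x.
Proof.
have [->|/one_sub_v_ge] := eqVneq x 0; first by rewrite v0 subrr.
by apply: le_trans; rewrite divr_ge0// ltW.
Qed.

Let one_sub_v_le x : x != 0 -> 1 - v x <= b ^+ l1norm x / D.
Proof. by move=> /vlb; lra. Qed.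

Let inbox_shift y : inbox r y -> inbox RR (y + x0).
Proof.
move=> /inboxP yr; move/inboxP : x0R => x0r; apply/inboxP => i.
rewrite ffunE rmorphD/=; apply: le_trans (ler_normD _ _) _.
by have := yr i; have := x0r i; lra.
Qed.

Let inbox_2R x : inbox RR x -> inbox (2 * RR) (x - x0).
Proof.
move=> /inboxP xR; move/inboxP : x0R => x0r; apply/inboxP => i.
rewrite !ffunE rmorphB/=; apply: le_trans (ler_normB _ _) _.
by have := xR i; have := x0r i; have := r0; lra.
Qed.

Let x0box : inbox RR x0. Proof. by have := inbox_shift box0; rewrite add0r. Qed.

Let bar0 x : 0 <= phibar x. Proof. by case: eigbar. Qed.
Let barr x : ~~ inbox r x -> phibar x = 0. Proof. by case: eigbar => -[+ _ _ _ _ _]; exact. Qed.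
Let bar1 : \sum_(x <- box d r) phibar x ^+ 2 = 1. Proof. by case: eigbar. Qed.

Let bar_nbsum x : x != 0 -> m * phibar x <= nbsum phibar x.
Proof.
have [eig _ _ _] := eigbar; apply: (eigen_nbsum_ge eig) => // y _ y0.
rewrite v0 subrr mulr0 oppr0 sub0r opprK mE -mulrA ler_pM2l//.
have := one_sub_v_ge y0; have : 0 <= c / D by rewrite divr_ge0// ltW.
by lra.
Qed.

Let bar_decay x : phibar x ^+ 2 <= (q ^+ 2) ^+ l1norm x.
Proof.
rewrite exprAC; apply: lerXn2r; rewrite ?nnegrE ?exprn_ge0//.
by rewrite -nmq; exact: (ground_state_decay (a := r)).
Qed.

Let q2b2 : b ^+ 2 * q ^+ 2 <= 2^-1.
Proof.
have -> : b ^+ 2 * q ^+ 2 = b ^+ 2 * K ^+ 2 * eps * eps by rewrite /q; ring.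
apply: le_trans bKeps; rewrite ler_piMr// mulr_ge0 ?(ltW eps0)// mulr_ge0 ?sqr_ge0//.
Qed.

Let bb2 : b <= b ^+ 2. Proof. by rewrite expr2 ler_peMl. Qed.

Let q2b : b * q ^+ 2 <= 2^-1.
Proof. by apply: le_trans q2b2; apply: ler_wpM2r; rewrite ?sqr_ge0. Qed.

(** At distance [k] the factor [1 - v] is at most [b ^+ k / D] and [phibar ^+ 2] at most
    [q ^+ (2 * k)]: a geometric sum, to which the origin contributes nothing. *)
Let one_sub_v_sum :
  \sum_(x <- box d r) (1 - v x) * phibar x ^+ 2 <= D^-1 * (S3 * (b * q ^+ 2)).
Proof.
apply: (@le_trans _ _ (D^-1 * \sum_(x <- box d r | x != 0) (b * q ^+ 2) ^+ l1norm x)).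
  rewrite mulr_sumr [leRHS]big_mkcond/=; apply: ler_sum => x _.
  have [->|x0'] := eqVneq x 0; first by rewrite v0 subrr mul0r.
  rewrite /= (exprMn (l1norm x) b) [leRHS]mulrA [X in _ <= X * _]mulrC.
  by apply: ler_pM; [|exact: sqr_ge0|exact: one_sub_v_le|exact: bar_decay].
apply: ler_wpM2l; first by rewrite invr_ge0 ltW.
by apply: sum_box_pow_le; rewrite q2b mulr_ge0// sqr_ge0.
Qed.

Let one_sub_v_sqr_sum :
  \sum_(x <- box d r) (1 - v x) ^+ 2 * phibar x ^+ 2 <=
  D^-1 ^+ 2 * (S3 * (b ^+ 2 * q ^+ 2)).
Proof.
apply: (@le_trans _ _ (D^-1 ^+ 2 * \sum_(x <- box d r | x != 0)
    (b ^+ 2 * q ^+ 2) ^+ l1norm x)).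
  rewrite mulr_sumr [leRHS]big_mkcond/=; apply: ler_sum => x _.
  have [->|x0'] := eqVneq x 0; first by rewrite v0 subrr expr0n mul0r.
  rewrite /= (exprMn (l1norm x) (b ^+ 2)) [leRHS]mulrA [X in _ <= X * _]mulrC.
  apply: ler_pM; [exact: sqr_ge0|exact: sqr_ge0| |exact: bar_decay].
  rewrite exprAC -exprMn; apply: lerXn2r; rewrite ?nnegrE//.
    by rewrite divr_ge0 ?exprn_ge0// ltW.
  exact: one_sub_v_le.
apply: ler_wpM2l; first by rewrite exprn_ge0// invr_ge0 ltW.
by apply: sum_box_pow_le; rewrite q2b2 mulr_ge0// sqr_ge0.
Qed.

Let z_sqr_sum :
  \sum_(x <- box d r) z (x + x0) ^+ 2 * phibar x ^+ 2 <=
  16 / D * (1 + `|s| * a) * (S3 * (b * (eta / eps) * q ^+ 2)).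
Proof.
have [e0 e1] := andP eta01.
have ee0 : 0 <= eta / eps by rewrite divr_ge0// ltW.
have C0 : 0 <= 16 / D * (1 + `|s| * a).
  by rewrite mulr_ge0 ?divr_ge0 ?addr_ge0 ?mulr_ge0// ltW.
apply: (@le_trans _ _ (16 / D * (1 + `|s| * a) * \sum_(x <- box d r | x != 0)
    (b * (eta / eps) * q ^+ 2) ^+ l1norm x)).
  rewrite mulr_sumr [leRHS]big_mkcond/= !big_seq; apply: ler_sum => x.
  rewrite mem_box => xr; have [->|x0'] := eqVneq x 0.
    by rewrite add0r subrr v0 mulr1 subrr expr0n mul0r.
  rewrite /= (exprMn (l1norm x) (b * (eta / eps))) [leRHS]mulrA.
  by apply: ler_pM; [exact: sqr_ge0|exact: sqr_ge0|exact: z2|exact: bar_decay].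
apply: ler_wpM2l => //; apply: sum_box_pow_le.
apply/andP; split; first by rewrite mulr_ge0 ?sqr_ge0// mulr_ge0.
apply: le_trans bKeps.
(* The [eps ^+ 2] inside [q ^+ 2] outweighs the [1 / eps] accompanying [eta], so the ratio is still
   small. *)
have -> : b * (eta / eps) * q ^+ 2 = (b * eta) * (K ^+ 2 * eps).
  by rewrite /q; field; rewrite !gt_eqF.
rewrite -[leRHS]mulrA; apply: ler_wpM2r; first by rewrite mulr_ge0 ?sqr_ge0// ltW.
by apply: le_trans bb2; rewrite ler_piMr.
Qed.

(** The weight converts distance into a factor [1 / a] at the edge of the small box, where [l1norm]
    is of order at least [r]. *)
Let h x : R := (l1norm x).+1%:R * phibar x ^+ 2.

Let h_sum : \sum_(x <- box d r) h x <= 1 + S3.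
Proof.
rewrite (bigD1_seq 0)/= ?mem_box ?box_uniq//; apply: lerD.
  rewrite /h l1norm0 mul1r -bar1.
  by apply: (@le_term_sum _ _ _ (fun x => phibar x ^+ 2));
    rewrite ?mem_box// => x; exact: sqr_ge0.
have q2 : 2 * q ^+ 2 <= 2^-1.
  have : q ^+ 2 <= 8^-1 ^+ 2 by apply: lerXn2r; rewrite ?nnegrE// invr_ge0.
  by lra.
(* The weight is absorbed into the ratio by [k + 1 <= 2 ^ k]. *)
apply: (@le_trans _ _ (\sum_(x <- box d r | x != 0) (2 * q ^+ 2) ^+ l1norm x)).
  apply: ler_sum => x _; rewrite /= (exprMn (l1norm x) 2).
  apply: ler_pM; [by []|exact: sqr_ge0| |exact: bar_decay].
  by rewrite -natrX ler_nat ltn_expl.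
apply: (@le_trans _ _ (S3 * (2 * q ^+ 2))).
  by apply: sum_box_pow_le; rewrite q2 mulr_ge0// sqr_ge0.
by rewrite ler_piMr//; lra.
Qed.

(** A neighbour of a site outside the box has weight at least [r / 2 >= a / 2], so there
    [phibar ^+ 2 <= 2 / a * h]. *)
Let nbsum_out y : ~~ inbox r y -> nbsum phibar y ^+ 2 <= n * (2 / a) * nbsum h y.
Proof.
move=> yr; apply: le_trans (sqr_nbsum_le _ _) _.
rewrite -(mulrA n); apply: ler_wpM2l => //.
have w z' : (l1norm y <= (l1norm z').+1)%N -> phibar z' ^+ 2 <= 2 / a * h z'.
  move=> yz; rewrite /h mulrA ler_peMl ?sqr_ge0// mulrAC ler_pdivlMr// mul1r.
  have := notin_box_l1norm yr; have : (l1norm y)%:R <= (l1norm z').+1%:R :> R by rewrite ler_nat.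
  by have := ar; lra.
rewrite /nbsum mulr_sumr; apply: ler_sum => i _; rewrite mulrDr; apply: lerD; apply: w.
  exact: l1norm_addu.
exact: l1norm_subu.
Qed.

Let psi0 x : 0 <= psi x. Proof. exact: bar0. Qed.

Let psi_out x : ~~ inbox RR x -> psi x = 0.
Proof.
move=> xR; apply: barr; apply: contra xR => /inbox_shift.
by rewrite subrK.
Qed.

Let psi1 : \sum_(x <- box d RR) psi x ^+ 2 = 1.
Proof.
rewrite -bar1 (@sum_box_shift _ _ RR r x0 (fun x => phibar x ^+ 2))//.
by move=> x /barr ->; rewrite expr0n.
Qed.

Let psim : m ^+ 2 * (1 - psi x0 ^+ 2) <= n ^+ 2.
Proof. by rewrite /psi subrr; apply: (@sum_sqr_off_le _ _ r) => //; exact: ltW. Qed.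

Let Mx0 : M x0 = 0. Proof. exact: subrr. Qed.

(** By [thetaa], [xi x0 >= 3 * a / 5]; the fluctuation [z] takes back at most a tenth of
    [a * (1 - v)], leaving [a / 2 * (1 - v) >= m]. *)
Let Mm x : inbox RR x -> x != x0 -> M x <= - m.
Proof.
move=> xR xx0; have xx0' : x - x0 != 0 by rewrite subr_eq0.
have := zS (inbox_2R xR); rewrite ler_norml => /andP[_ hz].
have hc := one_sub_v_ge xx0'.
have : a / 2 * (c / D) <= a / 2 * (1 - v (x - x0)).
  by apply: ler_wpM2l => //; rewrite divr_ge0// ltW.
rewrite -mE.
have : 2 / 5 * a * (1 - v (x - x0)) >= (a - xi x0) * (1 - v (x - x0)).
  apply: ler_wpM2r => //; move: xix0; rewrite ler_norml => /andP[+ _].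
  have := thetaa; lra.
move: (v (x - x0)) hz => u; rewrite /M => hz; lra.
Qed.

Let eigM : dirichlet_eigen RR M (lam - xi x0) phi.
Proof.
have [[out nz eq] _ _ _] := eigphi; split => // x /eq; rewrite /M; lra.
Qed.

Let phi0 x : 0 <= phi x. Proof. by case: eigphi. Qed.
Let phi1 : \sum_(x <- box d RR) phi x ^+ 2 = 1. Proof. by case: eigphi. Qed.

Local Notation rho := (residual lbar M psi).

(** The difference between [M], recentred at [x0], and the deterministic potential
    [- (a * (1 - v))]. *)
Let W y : R := z (y + x0) - s * (1 - v y).

Let rhoE x : inbox r (x - x0) -> rho x = W (x - x0) * phibar (x - x0).
Proof.
move=> xr; have [[_ _ eq] _ _ _] := eigbar.
rewrite /residual /psi !lapE nbsum_shift.
have := eq _ xr; rewrite lapE /W /M subrK; lra.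
Qed.

(** Beyond the translated small box only hopping out of it survives: this is the truncation
    error. *)
Let rho_out x : ~~ inbox r (x - x0) -> rho x = nbsum phibar (x - x0).
Proof.
move=> xr; rewrite /residual /psi lapE nbsum_shift barr//; ring.
Qed.

(** The three terms come, in order, from [s * (1 - v)], from [z] and from the truncation. *)
Definition residual_const : R :=
  2 * (theta ^+ 2 * S3 * b ^+ 2 * K ^+ 2) + 32 * (S3 * b * K ^+ 2) +
  2 * n ^+ 2 * (1 + S3).

Local Notation target := (eta * `|s| + a^-1).

Let ainv0 : 0 < a^-1. Proof. by rewrite invr_gt0. Qed.
Let target_ge0 : 0 <= eta * `|s|.
Proof. by rewrite mulr_ge0//; case/andP : eta01. Qed.

Let rho_sum : \sum_(x <- box d RR) rho x ^+ 2 <= residual_const * target.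
Proof.
pose F y := 2 * s ^+ 2 * ((1 - v y) ^+ 2 * phibar y ^+ 2) +
  2 * (z (y + x0) ^+ 2 * phibar y ^+ 2).
have F0 y : 0 <= F y.
  have sq u w : 0 <= u ^+ 2 * w ^+ 2 :> R by apply: mulr_ge0; exact: sqr_ge0.
  apply: addr_ge0; apply: mulr_ge0; [|exact: sq|by []|exact: sq].
  by apply: mulr_ge0; last exact: sqr_ge0.
have h0 y : 0 <= h y by rewrite /h mulr_ge0// sqr_ge0.
have hr y : ~~ inbox r y -> h y = 0 by move=> /barr; rewrite /h => ->; rewrite expr0n mulr0.
have na0 : 0 <= n * (2 / a) by rewrite mulr_ge0// divr_ge0// ltW.
have bound x : rho x ^+ 2 <= F (x - x0) + n * (2 / a) * nbsum (fun y => h (y - x0)) x.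
  have [xr|xr] := boolP (inbox r (x - x0)).
    apply: ler_wpDr; first by apply: mulr_ge0 => //; exact: nbsum_ge0.
    rewrite rhoE// /F /W.
    move: (xi (x - x0 + x0) - _) (1 - v (x - x0)) (phibar _) => A B P.
    have := sqr_ge0 ((A + s * B) * P); rewrite -subr_ge0 => hh; rewrite -subr_ge0.
    apply: le_trans hh _; rewrite le_eqVlt; apply/orP; left; apply/eqP; ring.
  by rewrite rho_out// nbsum_shift ler_wpDl// nbsum_out.
apply: (@le_trans _ _ (\sum_(x <- box d RR) F (x - x0) +
    n * (2 / a) * \sum_(x <- box d RR) nbsum (fun y => h (y - x0)) x)).
  by rewrite mulr_sumr -big_split/=; apply: ler_sum => x _; exact: bound.
have -> : \sum_(x <- box d RR) F (x - x0) = \sum_(y <- box d r) F y.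
  apply: sum_box_shift => // y /barr; rewrite /F => ->.
  by rewrite expr0n !mulr0 addr0.
have T4 : n * (2 / a) * \sum_(x <- box d RR) nbsum (fun y => h (y - x0)) x <=
    2 * n ^+ 2 * (1 + S3) * a^-1.
  have -> : 2 * n ^+ 2 * (1 + S3) * a^-1 = n * (2 / a) * (n * (1 + S3)).
    by field; rewrite gt_eqF.
  apply: ler_wpM2l => //; apply: le_trans.
    apply: (@sum_nbsum_le _ _ RR) => // x xR; apply: hr; apply: contra xR => /inbox_shift.
    by rewrite subrK.
  by apply: ler_wpM2l => //; rewrite (@sum_box_shift _ _ RR r x0 h).
have T23 : \sum_(y <- box d r) F y <=
    2 * (theta ^+ 2 * S3 * b ^+ 2 * K ^+ 2) * a^-1 + 32 * (S3 * b * K ^+ 2) * target.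
  rewrite /F big_split/= -!mulr_sumr; apply: lerD.
    apply: (@le_trans _ _ (2 * theta ^+ 2 * (D^-1 ^+ 2 * (S3 * (b ^+ 2 * q ^+ 2))))).
      apply: ler_pM; [| | |exact: one_sub_v_sqr_sum].
      - by apply: mulr_ge0; last exact: sqr_ge0.
      - by apply: sumr_ge0 => x _; apply: mulr_ge0; exact: sqr_ge0.
      apply: ler_wpM2l => //; rewrite -(real_normK (num_real s)).
      by apply: lerXn2r; rewrite ?nnegrE.
    (* Since [q / D = K / a], this term is of order [a ^- 2], of which one factor is dropped. *)
    have -> : 2 * theta ^+ 2 * (D^-1 ^+ 2 * (S3 * (b ^+ 2 * q ^+ 2))) =
        2 * (theta ^+ 2 * S3 * b ^+ 2 * K ^+ 2) * (a^-1 * a^-1).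
      by rewrite /q; move: theta S3 => th s3; field; rewrite !gt_eqF.
    apply: ler_wpM2l; first by rewrite !mulr_ge0 ?exprn_ge0 ?invr_ge0 ?(ltW c0).
    by rewrite ler_piMr ?(ltW ainv0)// invf_le1.
  apply: (@le_trans _ _ (2 * (16 / D * (1 + `|s| * a) * (S3 * (b * (eta / eps) * q ^+ 2))))).
    by apply: ler_wpM2l => //; exact: z_sqr_sum.
  (* Here [q ^+ 2 / (D * eps) = K ^+ 2 / a], and the division by [a] turns [1 + |s| * a] into
     [|s| + 1 / a]. *)
  have -> : 2 * (16 / D * (1 + `|s| * a) * (S3 * (b * (eta / eps) * q ^+ 2))) =
     32 * (S3 * b * K ^+ 2) * (eta * `|s| + eta * a^-1).
    by rewrite /q; field; rewrite !gt_eqF.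
  apply: ler_wpM2l; first by rewrite !mulr_ge0 ?exprn_ge0 ?invr_ge0 ?(ltW c0).
  by rewrite lerD2l ler_piMl ?(ltW ainv0)//; case/andP : eta01.
apply: le_trans (lerD T23 T4) _; rewrite /residual_const.
have ta : a^-1 <= target by rewrite lerDr.
have A0 : 0 <= 2 * (theta ^+ 2 * S3 * b ^+ 2 * K ^+ 2).
  by rewrite !mulr_ge0 ?exprn_ge0 ?invr_ge0 ?(ltW c0).
have B0 : 0 <= 2 * n ^+ 2 * (1 + S3).
  by rewrite mulr_ge0 ?addr_ge0// mulr_ge0// sqr_ge0.
move: A0 B0 (ler_wpM2l A0 ta) (ler_wpM2l B0 ta).
move: (2 * (theta ^+ 2 * S3 * b ^+ 2 * K ^+ 2)) (2 * n ^+ 2 * (1 + S3)) => A B _ _.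
move: (32 * (S3 * b * K ^+ 2)) => E hA hB.
by rewrite (mulrDl (A + E)) (mulrDl A); lra.
Qed.

(** Sites outside the small box drop out because [psi] vanishes there, and the centre because
    [W 0 = 0]. The first sum is [Phi] at [x0]. *)
Let rho_psi : \sum_(x <- box d RR) rho x * psi x =
  \sum_(y <- box d r | y != 0) phibar y ^+ 2 * z (y + x0) -
  s * \sum_(y <- box d r) (1 - v y) * phibar y ^+ 2.
Proof.
transitivity (\sum_(x <- box d RR) (fun y => W y * phibar y ^+ 2) (x - x0)).
  apply: eq_bigr => x _; rewrite /psi; have [xr|xr] := boolP (inbox r (x - x0)).
    by rewrite rhoE// expr2 mulrA.
  by rewrite barr// expr0n !mulr0.
rewrite (@sum_box_shift _ _ RR r x0 (fun y => W y * phibar y ^+ 2))//; last first.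
  by move=> y /barr ->; rewrite expr0n mulr0.
rewrite mulr_sumr [X in _ = X - _]big_mkcond/= -sumrB; apply: eq_bigr => y _.
have [->|_] := eqVneq y 0; rewrite /= /W; last by ring.
by rewrite add0r subrr v0; ring.
Qed.

Definition eigenvalue_const : R :=
  156 / c * residual_const + theta * S3 * b * K ^+ 2.

(** Two errors add up: the quadratic one, with [1 / m = 2 * eps / c], and the term [s * T1] of
    [rho_psi], of order [eps / a]. *)
Lemma fixed_scale_eigenvalue :
  `|lam - lbar - (xi x0 + \sum_(y <- box d r | y != 0) phibar y ^+ 2 * z (y + x0))|
    <= eigenvalue_const * eps * target.
Proof.
have := eigenvalue_perturbation lbar m0 nm x0box Mx0 Mm eigM phi0 phi1 psi0 psi_out psi1 psim.
rewrite rho_psi; set Ph := \sum_(y <- _ | _) _; set T1 := \sum_(y <- _) _.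
set X := lam - xi x0 - lbar - (Ph - s * T1) => hX.
have -> : lam - lbar - (xi x0 + Ph) = X - s * T1 by rewrite /X; ring.
apply: le_trans (ler_normB _ _) _.
have := le_trans hX (ler_wpM2l (ler0n R 78) rho_sum).
rewrite /eigenvalue_const; move: residual_const => rc {}hX.
rewrite -[leRHS]mulrA [leRHS]mulrDl; apply: lerD.
  move: hX; rewrite -ler_pdivlMl// => /le_trans; apply.
  rewrite le_eqVlt; apply/orP; left; apply/eqP; rewrite /m.
  by move: target => tg; field; rewrite !gt_eqF.
have T10 : 0 <= T1 by apply: sumr_ge0 => y _; apply: mulr_ge0 => //; exact: sqr_ge0.
rewrite normrM (ger0_norm T10).
apply: (@le_trans _ _ (theta * (D^-1 * (S3 * (b * q ^+ 2))))).
  by apply: ler_pM => //; exact: one_sub_v_sum.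
have -> : theta * (D^-1 * (S3 * (b * q ^+ 2))) = theta * S3 * b * K ^+ 2 * (eps * a^-1).
  by rewrite /q; move: theta S3 => th s3; field; rewrite !gt_eqF.
apply: ler_wpM2l; first by rewrite !mulr_ge0 ?exprn_ge0 ?invr_ge0 ?(ltW c0).
by apply: ler_wpM2l; [exact: ltW|rewrite lerDr].
Qed.

Definition eigenvector_const : R := 2 / c * Num.sqrt (320 * residual_const).

Lemma residual_const_ge0 : 0 <= residual_const.
Proof. by rewrite /residual_const !addr_ge0// !mulr_ge0 ?exprn_ge0 ?invr_ge0 ?(ltW c0)// addr_ge0. Qed.

Lemma fixed_scale_eigenvector :
  l2box RR (fun x => phi x - phibar (x - x0))
    <= eigenvector_const * eps * Num.sqrt target.
Proof.
have := eigenvector_perturbation lbar m0 nm x0box Mx0 Mm eigM phi0 phi1 psi0 psi_out psi1 psim.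
have t0 : 0 <= target by rewrite addr_ge0// ltW.
have rc0 : 0 <= 320 * residual_const by rewrite mulr_ge0// residual_const_ge0.
rewrite /l2box -ler_pdivlMl ?exprn_gt0// => hX.
have -> : eigenvector_const * eps * Num.sqrt target =
    Num.sqrt ((m ^+ 2)^-1 * (320 * (residual_const * target))).
  rewrite (mulrA 320) sqrtrM ?invr_ge0 ?sqr_ge0// (sqrtrM _ rc0).
  have mV0 : 0 <= m^-1 by rewrite invr_ge0 ltW.
  rewrite -exprVn sqrtr_sqr (ger0_norm mV0).
  rewrite /eigenvector_const [RHS]mulrA; congr (_ * _).
  rewrite [LHS]mulrAC; congr (_ * _); rewrite /m.
  by field; rewrite !gt_eqF.
apply: ler_wsqrtr; apply: le_trans hX _.
apply: ler_wpM2l; first by rewrite invr_ge0 sqr_ge0.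
by apply: ler_wpM2l => //; exact: rho_sum.
Qed.

End fixed_scale.

(** * Pointwise bound for [zeta] on the event *)

Section zeta_bound.
Context {R : realType} {dT : measure_display} {T : measurableType dT} {d : nat}.
Variables (P : probability T R) (xi : Zpt d -> T -> R) (v : Zpt d -> R).
Hypotheses (gf : gaussian_field P xi v) (v0 : v 0 = 1).

Lemma measurable_zeta x0 x : measurable_fun setT (zeta xi v x0 x).
Proof. by case: gf => mxi _; apply: measurable_funB => //; exact: measurable_funM. Qed.

(** In the variance of this two-term combination the two contributions [v (x - x0) ^+ 2] cancel. *)
Lemma zeta_law x0 x A : measurable A ->
  P (zeta xi v x0 x @^-1` A) =
  centred_gaussian_law (1 - v (x - x0) * v (x0 - x)) A.
Proof.
move=> mA; have [_ /(_ [:: (x, 1); (x0, - v (x - x0))] A mA)] := gf.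
rewrite !big_cons !big_nil/= !subrr v0.
have -> : (fun w => \sum_(p <- [:: (x, 1); (x0, - v (x - x0))]) p.2 * xi p.1 w) =
    zeta xi v x0 x.
  by apply/funext => w; rewrite !big_cons big_nil/= /zeta; ring.
by move=> ->; congr centred_gaussian_law; ring.
Qed.

(** The event bounds [zeta] in units of its standard deviation. The variance is at most [8 * s2]
    with [s2] at most [2 * expR c' ^+ k / D], whence the 16. *)
Lemma zeta_sqr_le (a D c c' kappa : R) x0 x w :
  0 < D -> D <= a -> 0 < c -> 0 < c' -> 0 < kappa -> (forall y, 0 <= v y) ->
  (forall y, y != 0 -> 1 - expR (c' * enorm y) / D <= v y <= 1 - c / D) ->
  x != x0 ->
  `|zeta xi v x0 x w| / Num.sqrt (fine ('V_P[zeta xi v x0 x])%E)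
     <= (a / D) `^ (kappa * enorm (x - x0)) *
        Num.sqrt (Num.max 1 (`|xi x0 w - a| * a)) ->
  zeta xi v x0 x w ^+ 2 <= 16 / D * (1 + `|xi x0 w - a| * a) *
    (expR c' * ((D / a) `^ (1 - 2 * kappa) / (D / a))) ^+ l1norm (x - x0).
Proof.
move=> D0 Da c0 c'0 k0 vge0 vb xx0; have a0 := lt_le_trans D0 Da.
set s2 := 1 - v (x - x0) * v (x0 - x).
have y0 : x - x0 != 0 by rewrite subr_eq0.
have y'0 : x0 - x != 0 by rewrite subr_eq0 eq_sym.
have cD : 0 < c / D by rewrite divr_gt0.
have [/andP[l1 u1] /andP[l2 u2]] := (vb _ y0, vb _ y'0).
have s20 : 0 < s2.
  rewrite /s2 subr_gt0; have := vge0 (x - x0); have := vge0 (x0 - x).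
  move: (v _) (v _) u1 u2 => u w0; nra.
have enormN : enorm (x0 - x) = enorm (x - x0) :> R.
  rewrite /enorm; congr Num.sqrt; apply: eq_bigr => i _.
  by rewrite !ffunE -sqrrN -rmorphN opprB.
set k := l1norm (x - x0).
have ek : expR (c' * enorm (x - x0)) <= expR c' ^+ k.
  rewrite -expRM_natr ler_expR ler_pM2l//; exact: enorm_le_l1norm.
have s2le : s2 <= 2 * (expR c' ^+ k / D).
  have : expR (c' * enorm (x - x0)) / D <= expR c' ^+ k / D.
    by apply: ler_wpM2r => //; rewrite invr_ge0 ltW.
  rewrite /s2; move: l2; rewrite enormN; have := vge0 (x - x0).
  have := vge0 (x0 - x).
  move: (v _) (v _) u1 u2 l1 => u w0; nra.
have mz := measurable_zeta x0 x.
have zlaw A : measurable A -> _ := @zeta_law x0 x A.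
have Vle := variance_gaussian_le mz s20 zlaw.
have V0 := variance_gaussian_gt0 mz s20 zlaw.
set V := fine _ in Vle V0 *.
rewrite ler_pdivrMr ?sqrtr_gt0// => zle.
set mx := Num.max _ _ in zle.
have sa0 : 0 <= `|xi x0 w - a| * a by rewrite mulr_ge0// ltW.
have mx0 : 0 <= mx by rewrite /mx le_max ler01.
have mxle : mx <= 1 + `|xi x0 w - a| * a.
  by rewrite /mx ge_max; apply/andP; split; lra.
have pw : ((a / D) `^ (kappa * enorm (x - x0))) ^+ 2 <=
    ((D / a) `^ (1 - 2 * kappa) / (D / a)) ^+ k.
  have aD1 : 1 <= a / D by rewrite ler_pdivlMr// mul1r.
  have -> : (D / a) `^ (1 - 2 * kappa) / (D / a) = (a / D) `^ (2 * kappa).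
    have eps0 : 0 < D / a by rewrite divr_gt0.
    have eV : (D / a)^-1 = (D / a) `^ (-1) by rewrite powR_inv1// ltW.
    rewrite -[a / D]invf_div eV -powRrM -powRD ?(gt_eqF eps0) ?implybT//.
    by congr powR; ring.
  rewrite -(powR_mulrn 2 (powR_ge0 _ _)) -(powR_mulrn k (powR_ge0 _ _)) -!powRrM; apply: ler_powR => //.
  by have := ler_wpM2l (ltW k0) (@enorm_le_l1norm R d (x - x0)); rewrite -/k; lra.
have : zeta xi v x0 x w ^+ 2 <= ((a / D) `^ (kappa * enorm (x - x0))) ^+ 2 * mx * V.
  rewrite -(real_normK (num_real (zeta _ _ _ _ _))).
  rewrite -(sqr_sqrtr mx0) -(sqr_sqrtr (ltW V0)) -!exprMn.
  by apply: lerXn2r; rewrite ?nnegrE// !mulr_ge0 ?powR_ge0 ?sqrtr_ge0.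
move/le_trans; apply.
have p0 : 0 <= ((a / D) `^ (kappa * enorm (x - x0))) ^+ 2 by exact: sqr_ge0.
rewrite exprMn.
set p1 := _ ^+ 2 in pw p0 *; set p2 := (_ / (D / a)) ^+ k in pw *.
set e1 := expR c' ^+ k in s2le *.
have -> : 16 / D * (1 + `|xi x0 w - a| * a) * (e1 * p2) =
  p2 * (1 + `|xi x0 w - a| * a) * (8 * (2 * (e1 / D))) by field; rewrite gt_eqF.
apply: ler_pM; [exact: mulr_ge0|exact: ltW|exact: ler_pM|].
by apply: le_trans Vle _; rewrite ler_pM2l.
Qed.

End zeta_bound.

(** * Positivity of the scale and asymptotic comparisons *)

Section eventual_bounds.
Context {R : realType} {d : nat}.

Definition axis_point (i0 : 'I_d) (N : nat) : Zpt d := [ffun j => if j == i0 then N%:Z else 0].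

Lemma enorm_axis_point i0 N : enorm (axis_point i0 N) = N%:R :> R.
Proof.
rewrite /enorm (bigD1 i0)//= big1 => [|i ii0]; last first.
  by rewrite ffunE (negbTE ii0) expr0n.
by rewrite ffunE eqxx addr0 sqrtr_sqr ger0_norm.
Qed.

(* A negative [D] would make [v >= 1] off the origin, against the decay of [v]. *)
Lemma scale_gt0 (D c' rad : R) (v : Zpt d -> R) : (0 < d)%N -> D != 0 -> 0 < c' ->
  (forall x, x != 0 -> 1 - expR (c' * enorm x) / D <= v x) ->
  (forall x, rad <= enorm x -> v x * ln (enorm x) <= 2^-1) -> 0 < D.
Proof.
move=> d0 D0 c'0 vlb vdecay; rewrite lt_neqAle eq_sym D0/= leNgt; apply/negP => Dlt0.
(* Beyond both [rad] and [e] the decay bound applies with a logarithm at least 1, which is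
   incompatible with [v x >= 1]. *)
pose t := Num.max rad (expR 1).
pose N := Num.bound t.
have t0 : 0 <= t by rewrite le_max expR_ge0 orbT.
have tN : t <= N%:R := ltW (archi_boundP t0).
pose x := axis_point (Ordinal d0) N.
have xE : enorm x = N%:R :> R by exact: enorm_axis_point.
have [radN eN] : rad <= N%:R /\ expR 1 <= N%:R :> R.
  by move: tN; rewrite /t ge_max => /andP[].
have N0 : 0 < N%:R :> R := lt_le_trans (expR_gt0 1) eN.
have x0 : x != 0.
  apply/eqP => xz; move: N0; rewrite -xE xz /enorm big1 ?sqrtr0 ?ltxx// => i _.
  by rewrite ffunE expr0n.
have lnN : 1 <= ln (N%:R : R) by rewrite -[leLHS](expRK 1) ler_ln// posrE expR_gt0.
have v1 : 1 <= v x.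
  apply: le_trans (vlb _ x0); rewrite lerBrDr gerDl.
  by rewrite mulr_ge0_le0 ?expR_ge0// invr_le0 ltW.
have := vdecay x; rewrite xE => /(_ radN).
have : 1 <= v x * ln (N%:R : R) by nra.
lra.
Qed.

Lemma negl_lt (u w : nat -> R) (e : R) : negl u w -> 0 < e ->
  \forall L \near \oo, u L / w L < e.
Proof.
move=> [_ /cvgrPdist_lt uw] e0; apply: filterS (uw _ e0) => L.
by rewrite sub0r normrN; apply: le_lt_trans; exact: ler_norm.
Qed.

End eventual_bounds.

(** * Choice of constants and reduction to the fixed-scale estimates *)

Theorem theorem4p2 (R : realType) (d : nat) (kappa : R)
    (dT : measure_display) (T : measurableType dT)
    (P : nat -> probability T R)
    (xi : nat -> Zpt d -> T -> R) (v : nat -> Zpt d -> R)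
    (dL a RL rL lbar : nat -> R) (phibar : nat -> Zpt d -> R) :
  (0 < d)%N ->
  0 < kappa < 3^-1 ->
  (* centred stationary Gaussian field, unit variance, non-negative covariance v_L *)
  (forall L, gaussian_field (P L) (xi L) (v L)) ->
  (forall L, v L 0 = 1) ->
  (forall L x, 0 <= v L x) ->
  (* (I) *)
  (forall e : R, 0 < e -> exists L1 : nat, forall L : nat, (L1 <= L)%N ->
     forall x : Zpt d, expR (Num.sqrt (ln (L%:R : R))) <= enorm x ->
       v L x * ln (enorm x) <= e) ->
  (* d_L : sup_{|x|=1} v_L(x) = 1 - 1/d_L *)
  (forall L, (forall x : Zpt d, enorm x = 1 :> R -> v L x <= 1 - (dL L)^-1) /\
             (exists x : Zpt d, enorm x = 1 :> R /\ v L x = 1 - (dL L)^-1)) ->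
  (* (II) *)
  (exists c c' : R, 0 < c /\ 0 < c' /\
     forall L (x : Zpt d), x != 0 ->
       1 - expR (c' * enorm x) / dL L <= v L x <= 1 - c / dL L) ->
  (* a_L : P(xi_L(0) > a_L) = L^{-d} *)
  (forall L : nat, (2 <= L)%N ->
     P L [set w | a L < xi L 0 w] = ((L%:R : R) ^- d)%:E) ->
  (* scales R_L, r_L *)
  negl a (fun L => ln (RL L)) ->
  negl (fun L => ln (RL L)) (fun L => a L ^+ 2 / dL L) ->
  (forall L : nat, (2 <= L)%N -> ln (a L) <= ln (rL L)) ->
  negl (fun L => ln (rL L)) (fun L => Num.sqrt (a L)) ->
  (* principal eigenpair of Delta - S_L on Q_{r_L}, S_L = a_L (1 - v_L) *)
  (forall L, principal_eigenpair (rL L) (fun x => - (a L * (1 - v L x)))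
                                 (lbar L) (phibar L)) ->
  (* standing assumptions: d_L << a_L, tau_L << a_L^{-1} (a_L/d_L)^{1/2} *)
  negl dL a ->
  negl (fun L => Num.sqrt (fine ('V_(P L)[Phi (xi L) (v L) (rL L) (phibar L) 0%R])%E))
       (fun L => (a L)^-1 * Num.sqrt (a L / dL L)) ->
  exists C : R, 0 < C /\
  exists L0 : nat, (1 <= L0)%N /\
  forall L : nat, (L0 <= L)%N ->
  forall x0 : Zpt d, inbox (RL L - rL L) x0 ->
  forall w : T, Eevent (P L) (xi L) (v L) (a L) (dL L) (RL L) kappa x0 w ->
  forall (lam : R) (phi : Zpt d -> R),
    principal_eigenpair (RL L) (fun x => xi L x w) lam phi ->
    `|lam - lbar L - Xi (xi L) (v L) (rL L) (phibar L) x0 w|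
      <= C * (dL L / a L) *
         ((dL L / a L) `^ (1 - 2 * kappa) * `|xi L x0 w - a L| + (a L)^-1)
    /\
    l2box (RL L) (fun x => phi x - phibar L (x - x0))
      <= C * (dL L / a L) *
         Num.sqrt ((dL L / a L) `^ (1 - 2 * kappa) * `|xi L x0 w - a L| + (a L)^-1).
Proof.
move=> d0 /andP[k0 k3] gf v0 vge0 condI dLdef [c [c' [c0 [c'0 condII]]]] _ _ neglRa
  lnar neglra eigbar negda _.
pose b := expR c'; pose K : R := 2 * (2 * d%:R) / c.
have b1 : 1 <= b by rewrite -[leLHS]expR0 ler_expR ltW.
have K0 : 0 <= K by rewrite divr_ge0 ?mulr_ge0// ltW.
pose C1 : R := eigenvalue_const (d := d) c b.
pose C2 : R := eigenvector_const (d := d) c b.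
exists (`|C1| + `|C2| + 1); split; first by rewrite ltr_wpDl// addr_ge0.
pose theta : R := (2 * d + 1)%:R.
have theta0 : 0 < 5 * theta by rewrite mulr_gt0// ltr0n addn1.
(* Level 1/2 is the one [scale_gt0] asks for to exclude a negative [dL L]. *)
have [L1 hI] := condI 2^-1 ltac:(by rewrite invr_gt0).
(* Keeping [dL L / a L] below these four thresholds yields in turn [Keps], [bKeps], [thetaa] and
   [a L >= 2]. The [+ 1] keeps the first two denominators positive. *)
have e1 : 0 < (8 * (K + 1))^-1 by rewrite invr_gt0 mulr_gt0// ltr_wpDl.
have e2 : 0 < (2 * (b ^+ 2 * K ^+ 2 + 1))^-1.
  by rewrite invr_gt0 mulr_gt0// ltr_wpDl// mulr_ge0 ?sqr_ge0.
have e3 : 0 < 2 / (5 * theta) by rewrite divr_gt0.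
have e4 : 0 < 2^-1 :> R by rewrite invr_gt0.
have large : \forall L \near \oo, [/\ (L1 <= L)%N, (2 <= L)%N, a L ^+ 2 / dL L != 0,
    Num.sqrt (a L) != 0 &
    [/\ dL L / a L < (8 * (K + 1))^-1, dL L / a L < (2 * (b ^+ 2 * K ^+ 2 + 1))^-1,
        dL L / a L < 2 / (5 * theta) & dL L / a L < 2^-1]].
  near=> L; split.
  - near: L; exact: nbhs_infty_ge.
  - near: L; exact: nbhs_infty_ge.
  - by near: L; case: neglRa.
  - by near: L; case: neglra.
  - by split; near: L; exact: negl_lt.
have [L2 _ hL2] := large.
exists L2.+1; split => // L L2L x0 x0R w E lam phi eigphi.
have [L1L L_ge2 dN0 sN0 [s1 s2 s3 s4]] := hL2 L (ltnW L2L).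
(* Division by 0 returns 0, so the non-vanishing quotient forces [dL L != 0]. *)
have D_neq0 : dL L != 0.
  by apply: contraNneq dN0 => ->; rewrite invr0 mulr0.
have vlb x : x != 0 -> 1 - expR (c' * enorm x) / dL L <= v L x.
  by move=> /(condII L)/andP[].
have vub x : x != 0 -> v L x <= 1 - c / dL L by move=> /(condII L)/andP[].
have D0 : 0 < dL L := scale_gt0 d0 D_neq0 c'0 vlb (hI L L1L).
(* The value [1 - (dL L)^-1] is attained by the non-negative [v L]. Once [dL L >= 1], a small ratio
   [dL L / a L] forces [a L] to be large. *)
have D1 : 1 <= dL L.
  have [_ [x [_ vx]]] := dLdef L.
  have := vge0 L x; rewrite vx subr_ge0 invf_le1//.
(* [Num.sqrt] is 0 on non-positive numbers, so a non-zero root gives the sign of [a L]. *)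
have a0 : 0 < a L by move: sN0; rewrite sqrtr_eq0 -ltNge.
have a_ge t : 0 < t -> dL L / a L < t -> t^-1 <= a L.
  move=> t0; rewrite ltr_pdivrMr// => h; rewrite -[leLHS]mul1r ler_pdivrMr//.
  by rewrite mulrC; lra.
have a2 : 2 <= a L by have := a_ge _ e4 s4; rewrite invrK.
(* [ln] is 0 on non-positive numbers: [0 < ln (a L) <= ln (rL L)] first gives [rL L > 0], and then
   the comparison. *)
have ar : a L <= rL L.
  have lna : 0 < ln (a L) by rewrite ln_gt0//; lra.
  have lnr := lt_le_trans lna (lnar L L_ge2).
  have r0 : 0 < rL L.
    by rewrite ltNge; apply/negP => /ln0 r0; rewrite r0 ltxx in lnr.
  by have := lnar L L_ge2; rewrite ler_ln ?posrE.
have thetaa : 5 * theta <= 2 * a L.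
  have := a_ge _ e3 s3; rewrite invf_div ler_pdivrMr//; lra.
have eps0 : 0 < dL L / a L by rewrite divr_gt0.
have eps1 : dL L / a L <= 1 by lra.
have Keps : K * (dL L / a L) <= 8^-1.
  apply: (@le_trans _ _ (K * (8 * (K + 1))^-1)); first by apply: ler_wpM2l => //; exact: ltW.
  rewrite ler_pdivrMr ?mulr_gt0 ?ltr_wpDl//; lra.
have bKeps : b ^+ 2 * K ^+ 2 * (dL L / a L) <= 2^-1.
  have B0 : 0 <= b ^+ 2 * K ^+ 2 by rewrite mulr_ge0 ?sqr_ge0.
  apply: (@le_trans _ _ (b ^+ 2 * K ^+ 2 * (2 * (b ^+ 2 * K ^+ 2 + 1))^-1)).
    by apply: ler_wpM2l => //; exact: ltW.
  by rewrite ler_pdivrMr ?mulr_gt0 ?ltr_wpDl//; move: B0; move: (b ^+ 2 * K ^+ 2) => B; lra.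
pose eta := (dL L / a L) `^ (1 - 2 * kappa).
have eta01 : 0 <= eta <= 1.
  rewrite powR_ge0/= [leRHS](_ : 1 = 1 `^ (1 - 2 * kappa) :> R); last by rewrite powR1.
  by apply: ge0_ler_powR; rewrite ?nnegrE ?(ltW eps0)//; lra.
have [E1 E2 E3] := E.
have vlb' x : x != 0 -> 1 - b ^+ l1norm x / dL L <= v L x.
  move=> x_neq0; apply: le_trans (vlb _ x_neq0); rewrite lerB// ler_wpM2r ?invr_ge0 ?(ltW D0)//.
  by rewrite /b -expRM_natr ler_expR ler_pM2l// enorm_le_l1norm.
(* The box of side [RL L - rL L] contains [x0], so its side is non-negative. *)
have rR : rL L <= RL L.
  move/inboxP : x0R => /(_ (Ordinal d0))/(le_trans (normr_ge0 _)); lra.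
have z2 y : inbox (rL L) y -> y != 0 ->
    (xi L (y + x0) w - xi L x0 w * v L (y + x0 - x0)) ^+ 2 <=
    16 / dL L * (1 + `|xi L x0 w - a L| * a L) * (b * (eta / (dL L / a L))) ^+ l1norm y.
  move=> yr y0; have yx0 : y + x0 != x0 by rewrite -subr_eq0 addrK.
  have yR : inbox (RL L) (y + x0 - x0).
    by rewrite addrK; move/inboxP : yr => yr; apply/inboxP => i; have := yr i; lra.
  have := @zeta_sqr_le _ _ _ _ (P L) (xi L) (v L) (gf L) (v0 L) (a L) (dL L) c c' kappa
    x0 (y + x0) w D0 _ c0 c'0 k0 (vge0 L) (condII L) yx0 (E3 _ yR yx0).
  rewrite /zeta addrK; apply; rewrite -[leRHS]mul1r -ler_pdivrMr//.
have ev := fixed_scale_eigenvalue (xi := fun x => xi L x w) D0 _ ar thetaa c0 b1 eta01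
  eps1 Keps bKeps (v0 L) vlb' vub x0R (ltW E1) E2 z2 (eigbar L) eigphi.
have evec := fixed_scale_eigenvector (xi := fun x => xi L x w) D0 _ ar thetaa c0 b1 eta01
  eps1 Keps bKeps (v0 L) vlb' vub x0R (ltW E1) E2 z2 (eigbar L) eigphi.
have a1 : 1 <= a L by lra.
have tg0 : 0 <= eta * `|xi L x0 w - a L| + (a L)^-1.
  by rewrite addr_ge0 ?mulr_ge0 ?invr_ge0 ?(ltW a0)//; case/andP : eta01.
split.
- apply: le_trans (ev a1) _; apply: ler_wpM2r => //; apply: ler_wpM2r; first exact: ltW.
  rewrite -/C1; have := ler_norm C1; have := normr_ge0 C2; lra.
- apply: le_trans (evec a1) _; apply: ler_wpM2r; first exact: sqrtr_ge0.
  apply: ler_wpM2r; first exact: ltW.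
  rewrite -/C2; have := ler_norm C2; have := normr_ge0 C1; lra.
Unshelve. all: by end_near.
Qed.
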